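(* Let $S$ be a solenoid and $K$ be a Knaster continuum. Then $K\times S$ has the fupcon property; that is, for every continuum $M\subseteq K\times S$ with $\pi_K(M)=K$ and $\pi_S(M)=S$, and for every open set $U\subseteq K\times S$ with $M\subseteq U$, there exists an open connected set $V$ with $M\subseteq V\subseteq U$.
   Context: A continuum is a nonempty compact connected metric space. A solenoid is a continuum homeomorphic to an inverse limit $\varprojlim\{\mathbb{S}^1, f_i\}$ of unit circles with bonding maps $f_i(z)=z^{n_i}$, each $n_i\geq 2$ an integer. A Knaster continuum is a continuum homeomorphic to an inverse limit of arcs $[0,1]$ with open surjective bonding maps. For a product $X\times Y$ of continua, $\pi_X,\pi_Y$ denote the coordinate projections. $X\times Y$ has the fupcon property if every subcontinuum $M\subseteq X\times Y$ with $\pi_X(M)=X$ and $\pi_Y(M)=Y$ has the property that for every open $U\supseteq M$ there is an open connected $V$ with $M\subseteq V\subseteq U$. *)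

(* Defs.v *)
From HB Require Import structures.
From mathcomp Require Import all_boot all_order all_algebra.
From mathcomp Require Import all_classical all_reals all_analysis.
Set Implicit Arguments. Unset Strict Implicit. Unset Printing Implicit Defensive.
Import Order.TTheory GRing.Theory Num.Theory.
Import numFieldNormedType.Exports.
Local Open Scope classical_set_scope.
Local Open Scope ring_scope.

Section Defs.
Variable R : realType.

Definition I01 : set R := `[0, 1]%classic.

(** A map f : [0,1] -> [0,1] (represented by f : R -> R, only its values on
    [0,1] matter) that is continuous, surjective onto [0,1] and open
    (images of relatively open subsets of [0,1] are relatively open). *)
Definition open_surj_I01_map (f : R -> R) : Prop :=
  [/\ {within I01, continuous f},
      f @` I01 = I01 &
      forall O : set R, open O ->
        exists O' : set R, open O' /\ f @` (O `&` I01) = O' `&` I01].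

Definition arc_inverse_limit (f : nat -> R -> R) : set {ptws nat -> R} :=
  [set x | forall i, I01 (x i) /\ x i = f i (x i.+1)].

Definition circle : set ((R * R)%type) := [set z | z.1 ^+ 2 + z.2 ^+ 2 = 1].
Definition cmul (z w : (R * R)%type) : (R * R)%type :=
  (z.1 * w.1 - z.2 * w.2, z.1 * w.2 + z.2 * w.1).
Definition cpow (n : nat) (z : (R * R)%type) : (R * R)%type := iter n (cmul z) (1, 0).

Definition circle_inverse_limit (n : nat -> nat) : set {ptws nat -> (R * R)%type} :=
  [set x | forall i, circle (x i) /\ x i = cpow (n i) (x i.+1)].
End Defs.

Definition homeomorphic_to_subspace (X T : topologicalType) (L : set T) : Prop :=
  exists (h : X -> T) (g : T -> X),
    [/\ continuous h, {within L, continuous g},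
        forall x, L (h x), forall x, g (h x) = x &
        forall y, L y -> h (g y) = y].

Definition is_solenoid (R : realType) (Y : topologicalType) : Prop :=
  exists n : nat -> nat, (forall i, (2 <= n i)%N) /\
    homeomorphic_to_subspace Y (@circle_inverse_limit R n).

Definition is_Knaster_continuum (R : realType) (X : topologicalType) : Prop :=
  exists f : nat -> R -> R, (forall i, open_surj_I01_map (f i)) /\
    homeomorphic_to_subspace X (@arc_inverse_limit R f).

Definition subcontinuum (T : topologicalType) (M : set T) : Prop :=
  [/\ M !=set0, compact M & connected M].

Definition fupcon (X Y : topologicalType) : Prop :=
  forall M : set (X * Y), subcontinuum M ->
    fst @` M = setT -> snd @` M = setT ->
    forall U : set (X * Y), open U -> M `<=` U ->
      exists V : set (X * Y), [/\ open V, connected V, M `<=` V & V `<=` U].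

(* Main.v *)
Require Import Defs.
From mathcomp Require Import all_boot all_order all_algebra.
From mathcomp Require Import zify ring lra.
From mathcomp Require Import all_classical all_reals all_analysis.
Set Implicit Arguments. Unset Strict Implicit. Unset Printing Implicit Defensive.
Import Order.TTheory GRing.Theory Num.Theory.
Import numFieldNormedType.Exports.
Local Open Scope classical_set_scope.
Local Open Scope ring_scope.

(* By compactness of M it suffices to look at one level m of the inverse
   limits, that is, at the image of M in the annulus [0,1] x S^1, covered by
   [0,1] x R. Cut the strip into squares of mesh 1/k; V is the preimage of the
   union of the squares met by M, and the heart of the matter is that these
   squares form a connected family in the strip.
   - Winding: at a level m + r whose circle covers that of level m more than
     k + 1 times, a connected class of squares already carries all of M, because
     M is connected, and M projects onto that long circle. By the pigeonhole
     principle the class contains two squares differing by a nonzero number of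
     turns.
   - Planarity: a periodic walk invariant under d > 0 turns separates the top
     from the bottom of its translate by one turn, so the two walks meet and the
     class is invariant under one turn. The class then contains every square.
   Open maps of [0,1] have a section through every point, and arcs of the
   solenoid through a point of V return densely to each fiber. Hence a
   connected component of V containing (x, y) contains all (x, y') in V, in
   particular a point of M since M projects onto K. *)

(** * Crossing walks in the plane lattice *)

Definition adj (g h : int * int) : bool :=
  (`|g.1 - h.1| <= 1) && (`|g.2 - h.2| <= 1).

(** The value 0 counts as upper, so a unit step flips exactly between -1 and 0 and no general
    position is needed. *)
Definition upper (y : int) : int := if 0 <= y then 1 else 0.

(* Signed crossing, by the step from (x, y) to (_, y'), of the ray y = 0 < x. *)
Definition raycross (x y y' : int) : int :=
  if 0 < x then upper y' - upper y else 0.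

(** A flip puts y and y' at -1 and 0. As (x, y) lies outside the central 3 by 3 block, |x| is at
    least 2, and a unit step cannot change the sign of x. *)
Lemma upper_flip (x y x' y' : int) :
  `|x - x'| <= 1 -> `|y - y'| <= 1 -> ~~ ((`|x| <= 1) && (`|y| <= 1)) ->
  upper y <> upper y' -> 2 <= `|x| /\ (0 < x') = (0 < x).
Proof. by rewrite /upper; do 2!case: ifP => ?; lia. Qed.

(** Discrete homotopy invariance: the two sums count crossings along the two ways around a square of
    difference vectors. By [upper_flip], if some side flips, x is positive at all the corners where
    it is read or at none, so both sums telescope alike. *)
Lemma raycross_cell (a a' b b' : int * int) :
  adj a a' -> adj b b' ->
  ~~ adj a b -> ~~ adj a' b -> ~~ adj a b' -> ~~ adj a' b' ->
  raycross (a.1 - b.1) (a.2 - b.2) (a'.2 - b.2) +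
  raycross (a'.1 - b.1) (a'.2 - b.2) (a'.2 - b'.2) =
  raycross (a.1 - b.1) (a.2 - b.2) (a.2 - b'.2) +
  raycross (a.1 - b'.1) (a.2 - b'.2) (a'.2 - b'.2).
Proof.
case: a a' b b' => [a1 a2] [a1' a2'] [b1 b2] [b1' b2'].
move=> /andP[/= ha1 ha2] /andP[/= hb1 hb2]; rewrite /adj /= => H00 H10 H01 H11.
have cA c : `|(a1 - c) - (a1' - c)| <= 1 by clear -ha1; lia.
have cA2 c : `|(a2 - c) - (a2' - c)| <= 1 by clear -ha2; lia.
have cB c : `|(c - b1) - (c - b1')| <= 1 by clear -hb1; lia.
have cB2 c : `|(c - b2) - (c - b2')| <= 1 by clear -hb2; lia.
have sameA c : 2 <= `|a1 - c| -> (0 < a1' - c) = (0 < a1 - c) by clear -ha1; lia.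
have sameA' c : 2 <= `|a1' - c| -> (0 < a1 - c) = (0 < a1' - c) by clear -ha1; lia.
have sameB c : 2 <= `|c - b1| -> (0 < c - b1') = (0 < c - b1) by clear -hb1; lia.
have sameB' c : 2 <= `|c - b1'| -> (0 < c - b1) = (0 < c - b1') by clear -hb1; lia.
rewrite /raycross.
have [e1|/eqP ne] := eqVneq (upper (a2 - b2)) (upper (a2' - b2)); last first.
  have [f1 ->] := upper_flip (cA _) (cA2 _) H00 ne.
  by rewrite (sameB _ f1); case: ifP => _ //; rewrite [LHS]addrC [RHS]addrC !subrKA.
have [e2|/eqP ne] := eqVneq (upper (a2' - b2)) (upper (a2' - b2')); last first.
  have [f1 e3] := upper_flip (cB _) (cB2 _) H10 ne.
  have f2 : 2 <= `|a1' - b1'|.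
    have := cB a1'; have := cB2 a2'; rewrite distrC [in X in _ -> X -> _]distrC => h1 h2.
    by have [] := upper_flip h2 h1 H11 (nesym ne).
  rewrite (sameA' _ f2) (sameA' _ f1) e3.
  by case: ifP => _ //; rewrite [LHS]addrC [RHS]addrC !subrKA.
have [e3|/eqP ne] := eqVneq (upper (a2 - b2)) (upper (a2 - b2')); last first.
  have [f1 e3] := upper_flip (cB _) (cB2 _) H00 ne.
  by rewrite (sameA _ f1) e3; case: ifP => _ //; rewrite [LHS]addrC [RHS]addrC !subrKA.
by rewrite -e2 -e1 -e3 !subrr !if_same.
Qed.

(** First coordinates are heights, second ones run from left to right. If the walks stayed apart,
    the signed number of times that [A] crosses the ray rising from [B t] would not depend on t; yet
    it is 0 for [B 0], which no point of [A] exceeds in height, and 1 for [B b], which no point of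
    [A] is below. *)
Lemma walks_meet (a b : nat) (A B : nat -> int * int) :
  (forall s, (s < a)%N -> adj (A s) (A s.+1)) ->
  (forall t, (t < b)%N -> adj (B t) (B t.+1)) ->
  (forall s, (s <= a)%N -> (A s).1 <= (B 0%N).1) ->
  (forall s, (s <= a)%N -> (B b).1 <= (A s).1) ->
  (forall t, (t <= b)%N -> (A 0%N).2 < (B t).2) ->
  (forall t, (t <= b)%N -> (B t).2 < (A a).2) ->
  exists s t, [/\ (s <= a)%N, (t <= b)%N & adj (A s) (B t)].
Proof.
move=> stA stB top bot left right.
apply: contrapT => /forallNP noadj.
have far s t : (s <= a)%N -> (t <= b)%N -> ~~ adj (A s) (B t).
  by move=> sa tb; apply/negP => ?; case: (noadj s); exists t; split.
pose H s t := raycross ((A s).1 - (B t).1) ((A s).2 - (B t).2)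
                       ((A s.+1).2 - (B t).2).
have rowS t : (t < b)%N -> \sum_(s < a) H s t = \sum_(s < a) H s t.+1.
  move=> tb.
  (* The crossing due to one step of [B] while [A] rests at s. When [raycross_cell] is summed along
     [A], only the two ends remain, and they vanish because the ends of [A] lie to the left and to
     the right of [B]. *)
  pose V s := raycross ((A s).1 - (B t).1) ((A s).2 - (B t).2)
                       ((A s).2 - (B t.+1).2).
  suff: forall c, (c <= a)%N ->
      \sum_(s < c) H s t + V c = V 0%N + \sum_(s < c) H s t.+1.
    move=> /(_ a (leqnn a)).
    have L c : (c <= b)%N -> upper ((A 0%N).2 - (B c).2) = 0.
      by move=> cb; rewrite /upper subr_ge0 leNgt left.
    have Rt c : (c <= b)%N -> upper ((A a).2 - (B c).2) = 1.
      by move=> cb; rewrite /upper subr_ge0 (ltW (right c cb)).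
    have V0 : V 0%N = 0 by rewrite /V /raycross !L ?(ltnW tb) // subrr if_same.
    have Va : V a = 0 by rewrite /V /raycross !Rt ?(ltnW tb) // subrr if_same.
    by rewrite V0 Va addr0 add0r.
  elim=> [_|c IH ca]; first by rewrite !big_ord0; lia.
  move: (IH (ltnW ca)).
  have : H c t + V c.+1 = V c + H c t.+1 := raycross_cell (stA _ ca) (stB _ tb) (far _ _ (ltnW ca) (ltnW tb))
    (far _ _ ca (ltnW tb)) (far _ _ (ltnW ca) tb) (far _ _ ca tb).
  by move=> h1 h2; rewrite !big_ord_recr /= -addrA h1 addrA h2 addrA.
have row t : (t <= b)%N -> \sum_(s < a) H s 0%N = \sum_(s < a) H s t.
  by elim: t => // t IH tb; rewrite (IH (ltnW tb)) rowS.
have row0 : \sum_(s < a) H s 0%N = 0.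
  rewrite big1 // => s _; have := top s (ltnW (ltn_ord s)).
  by rewrite /H /raycross; case: ifP => //; lia.
have rowb c : (c <= a)%N ->
    \sum_(s < c) H s b = upper ((A c).2 - (B b).2) - upper ((A 0%N).2 - (B b).2).
  elim: c => [|c IH ca]; first by rewrite big_ord0 subrr.
  rewrite big_ord_recr /= (IH (ltnW ca)) addrC.
  suff -> : H c b = upper ((A c.+1).2 - (B b).2) - upper ((A c).2 - (B b).2).
    by rewrite subrKA.
  (* By [bot] the height difference can only be 0 here, where [upper_flip] excludes a flip. *)
  rewrite /H /raycross; case: ltrP => // le0.
  apply/eqP; rewrite eq_sym subr_eq0; apply: contraT => /eqP ne0; have ne := nesym ne0.
  have /andP[st1 st2] := stA c ca.
  have d1 : `|((A c).1 - (B b).1) - ((A c.+1).1 - (B b).1)| <= 1.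
    by clear -st1; lia.
  have d2 : `|((A c).2 - (B b).2) - ((A c.+1).2 - (B b).2)| <= 1.
    by clear -st2; lia.
  have [f1 _] := upper_flip d1 d2 (far c b (ltnW ca) (leqnn b)) ne.
  by move: (bot c (ltnW ca)) f1 le0; clear; lia.
have := row b (leqnn b); rewrite row0 rowb // /upper !subr_ge0.
by rewrite (ltW (right _ _)) // leNgt left.
Qed.

(* Walks are total sequences; they may rest, as [adj] is reflexive. *)
Definition reach (G : int * int -> Prop) (g h : int * int) : Prop :=
  exists (w : nat -> int * int) (n : nat),
    [/\ w 0%N = g, w n = h, forall s, G (w s) & forall s, adj (w s) (w s.+1)].

Definition shift (l : int) (g : int * int) : int * int := (g.1, g.2 + l).

Lemma shiftD l m g : shift l (shift m g) = shift (m + l) g.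
Proof. by rewrite /shift /= addrA. Qed.

Lemma shift0 g : shift 0 g = g.
Proof. by case: g => i j; rewrite /shift /= addr0. Qed.

Lemma adj_shift l g h : adj (shift l g) (shift l h) = adj g h.
Proof. by rewrite /adj /= opprD addrACA subrr addr0. Qed.

Lemma adjC g h : adj g h = adj h g.
Proof. by rewrite /adj distrC [`|g.2 - _|]distrC. Qed.

Lemma adjxx g : adj g g.
Proof. by rewrite /adj !subrr normr0. Qed.

Section Reach.
Variable G : int * int -> Prop.

Lemma reach_l g h : reach G g h -> G g.
Proof. by case=> w [n [<- _ Gw _]]. Qed.

Lemma reach_sym g h : reach G g h -> reach G h g.
Proof.
case=> w [n [w0 wn Gw aw]]; exists (fun s => w (n - s)%N), n.
split; rewrite ?subn0 ?subnn // => s.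
have [sn|ns] := ltnP s n; first by rewrite adjC -(subnSK sn).
(* Past n both truncated differences are 0: the reversed walk rests at [w 0]. *)
have -> : (n - s.+1 = n - s)%N by lia.
exact: adjxx.
Qed.

Lemma reach_trans h g k : reach G g h -> reach G h k -> reach G g k.
Proof.
case=> w [n [w0 wn Gw aw]] [v [m [v0 vm Gv av]]].
exists (fun s => if (s <= n)%N then w s else v (s - n)%N), (n + m)%N; split=> //.
- case: m vm => [|m] vm; first by rewrite addn0 leqnn wn -vm v0.
  by rewrite ifF ?addKn //; lia.
- by move=> s; case: ifP.
- move=> s; have [sn|ns|->] := ltngtP s n; first exact: aw.
  + by rewrite subSn // ltnW.
  + by rewrite subSnn wn -v0; exact: av.
Qed.

Lemma reach_adj g h : G g -> G h -> adj g h -> reach G g h.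
Proof.
move=> Gg Gh gh; exists (fun s => if s is 0%N then g else h), 1%N.
by split=> //; case=> // s; exact: adjxx.
Qed.

Lemma reach_walk w i j :
  (forall s, G (w s)) -> (forall s, adj (w s) (w s.+1)) -> reach G (w i) (w j).
Proof.
move=> Gw aw; wlog ij : i j / (i <= j)%N.
  by move=> H; case: (leqP i j) => [|/ltnW] /H // /reach_sym.
exists (fun s => w (i + s)%N), (j - i)%N.
by split=> [||s|s] //; rewrite ?addn0 ?subnKC // addnS.
Qed.

End Reach.

(** * Walks in periodic lattice sets *)

Lemma max_upto (f : nat -> int) n :
  exists2 s, (s <= n)%N & forall t, (t <= n)%N -> f t <= f s.
Proof.
elim: n => [|n [s sn IH]]; first by exists 0%N => // t; rewrite leqn0 => /eqP->.
have [le|lt] := lerP (f s) (f n.+1).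
  exists n.+1 => // t; rewrite leq_eqVlt => /predU1P[->//|/IH tn].
  exact: le_trans tn le.
exists s => [|t]; first exact: leqW.
by rewrite leq_eqVlt => /predU1P[->|/IH //]; exact: ltW.
Qed.

(* The bi-infinite periodic walk through g and its translates separates a
   highest from a lowest point of its translate by p, hence comes next to it. *)
Lemma reach_period (G : int * int -> Prop) (p : int) (d : nat) (g : int * int) :
  (forall l h, G h -> G (shift (l * p) h)) -> 0 < p -> (0 < d)%N ->
  reach G g (shift (d%:Z * p) g) -> reach G g (shift p g).
Proof.
move=> per p0 d0 [w [n [w0 wn Gw aw]]].
have Gp h : G h -> G (shift p h) by rewrite -[p]mul1r; exact: per.
set P := d%:Z * p in wn.
have P0 : 0 < P by rewrite /P mulr_gt0 // ltz_nat.
have n0 : (0 < n)%N.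
  rewrite lt0n; apply: contraPneq wn => ->; rewrite w0; case: (g) => i j [].
  by move: P0; clear; lia.
have [s1 s1n top] := max_upto (fun s => (w s).1) n.
have [s0 s0n /= bot] := max_upto (fun s => - (w s).1) n.
have [s2 s2n /= bd] := max_upto (fun s => `|(w s).2|) n.
set J := `|(w s2).2| in bd.
(* With q periods on each side of g, the walk [A] starts to the left of the translate by p of one
   period of w, and ends to its right. *)
pose q := `|(J + J + p + 1)%R|%N.
pose A s := shift ((s %/ n)%N%:Z * P - q%:Z * P) (w (s %% n)%N).
have qP : J + J + p + 1 <= q%:Z * P.
  apply: (@le_trans _ _ q%:Z); first by rewrite /q; lia.
  by rewrite ler_peMr //; lia.
have GA s : G (A s).
  by rewrite /A -mulrBl /P mulrA; apply: per.
have aA s : adj (A s) (A s.+1).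
  rewrite /A modnS divnS //; case: ifP => [dv|_]; last by rewrite add0n adj_shift.
  have e : (s %% n).+1 = n.
    apply/eqP; rewrite eqn_leq ltn_pmod //= dvdn_leq //.
    by rewrite -(dvdn_addr _ (dvdn_mull (s %/ n) (dvdnn n))) addnS -divn_eq.
  have -> : w 0%N = shift (- P) (w (s %% n).+1) by rewrite e wn w0 shiftD subrr shift0.
  rewrite shiftD PoszD mulrDl mul1r !addrA addNr add0r.
  by rewrite adj_shift.
(* The transversal walk follows w from a highest to a lowest point, backwards when the lowest one
   comes first. *)
have [b [e [e0 eb en ae]]] : exists (b : nat) (e : nat -> nat), [/\ e 0%N = s1, e b = s0,
    forall t, (t <= b)%N -> (e t <= n)%N & forall t, (t < b)%N -> adj (w (e t)) (w (e t.+1))].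
  have [le|/ltnW le] := leqP s1 s0.
    exists (s0 - s1)%N, (fun t => (s1 + t)%N); split=> [||t ?|t ?]; try lia.
    by rewrite addnS.
  exists (s1 - s0)%N, (fun t => (s1 - t)%N); split=> [||t ?|t tb]; try lia.
  have ts1 : (t < s1)%N by lia.
  by rewrite adjC -(subnSK ts1).
have modle s : (s %% n <= n)%N by rewrite ltnW // ltn_pmod.
have [||||||s [t [sa tb st]]] :=
    @walks_meet (2 * q * n)%N b A (fun t => shift p (w (e t))).
- by move=> s _.
- by move=> t tb; rewrite adj_shift; exact: ae.
- by move=> s _; rewrite /= e0 top.
- by move=> s _; rewrite /= eb -lerN2; exact: bot.
- move=> t tb; rewrite /A /= div0n mod0n mul0r sub0r.
  by move: (bd 0%N isT) (bd _ (en t tb)) qP p0; clear; lia.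
- move=> t tb; rewrite /A /= mulnK // modnMl mul2n -addnn PoszD mulrDl addrK.
  by move: (bd 0%N isT) (bd _ (en t tb)) qP p0; clear; lia.
have Aq : A (q * n)%N = g by rewrite /A mulnK // modnMl subrr shift0.
rewrite -{1}Aq; apply: reach_trans (reach_walk _ s GA aA) _.
apply: (@reach_trans _ (shift p (w (e t)))).
  by apply: reach_adj => //; apply: Gp.
rewrite -w0; apply: (@reach_walk _ (fun s => shift p (w s))) => // u.
  exact: Gp.
by rewrite adj_shift.
Qed.

Section PeriodicReach.
Variables (G : int * int -> Prop) (p : int).
Hypothesis per : forall l h, G h -> G (shift (l * p) h).

Lemma reach_shift l g h :
  reach G g h -> reach G (shift (l * p) g) (shift (l * p) h).
Proof.
case=> w [n [<- <- Gw aw]]; exists (fun s => shift (l * p) (w s)), n.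
by split=> // s; [exact: per|rewrite adj_shift].
Qed.

(** [reach_period] replaces d turns by one turn, hence by any number of turns; a class that contains
    some translate of each point then contains the point itself. *)
Lemma reach_all (d : int) g :
  0 < p -> d != 0 -> reach G g (shift (d * p) g) ->
  (forall h, G h -> exists l, reach G g (shift (l * p) h)) ->
  forall h, G h -> reach G g h.
Proof.
move=> p0 d0 gd cover h Gh.
have one : reach G g (shift p g).
  have [n n0 gn] : exists2 n : nat, (0 < n)%N & reach G g (shift (n%:Z * p) g).
    case: d d0 gd => n n0 gn; first by exists n => //; move: n0; clear; lia.
    exists n.+1 => //; apply/reach_sym.
    have := reach_shift n.+1 gn; rewrite shiftD -mulrDl.
    by rewrite (_ : Negz n + n.+1 = 0) ?mul0r ?shift0 //; clear; lia.
  exact: reach_period n0 gn.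
have pos (n : nat) : reach G g (shift (n%:Z * p) g).
  elim: n => [|n IH].
    by rewrite mul0r shift0; apply: reach_trans one (reach_sym one).
  apply: reach_trans IH _.
  have := reach_shift n one; rewrite shiftD.
  by rewrite (_ : p + n%:Z * p = n.+1%:Z * p) // -{1}[p]mul1r -mulrDl; congr (_ * _); lia.
have all_l l : reach G g (shift (l * p) g).
  case: l => n; first exact: pos.
  have := reach_sym (reach_shift (Negz n) (pos n.+1)).
  by rewrite shiftD -mulrDl (_ : n.+1%:Z + Negz n = 0) ?mul0r ?shift0 //; clear; lia.
have [l gl] := cover h Gh.
have := reach_shift (- l) gl; rewrite shiftD -mulrDl subrr mul0r shift0.
exact: reach_trans (all_l _).
Qed.

End PeriodicReach.

(** * The circle *)

Section Circle.
Variable R : realType.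
Implicit Types (s t : R) (z : (R * R)%type).

(** The covering of the circle by t -> e^(2 pi i t), of period 1. *)
Definition expi t : (R * R)%type := (cos (pi *+ 2 * t), sin (pi *+ 2 * t)).

Lemma circle_expi t : circle (expi t).
Proof. exact: cos2Dsin2. Qed.

Lemma expiD s t : expi (s + t) = cmul (expi s) (expi t).
Proof. by rewrite /expi /cmul mulrDr cosD sinD /= [cos _ * sin _ + _]addrC. Qed.

Lemma cpow_expi n t : cpow n (expi t) = expi (n%:R * t).
Proof.
rewrite /cpow; elim: n => [|n IH]; first by rewrite mul0r /expi mulr0 cos0 sin0.
by rewrite iterS IH -expiD -natr1 mulrDl mul1r addrC.
Qed.

Lemma expiDint t (l : int) : expi (t + l%:~R) = expi t.
Proof.
have pos (n : nat) u : expi (u + n%:R) = expi u.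
  rewrite /expi mulrDr mulr_natr.
  by rewrite (periodicn (@cosD2pi R)) (periodicn (@sinD2pi R)).
case: l => n; first exact: pos.
by rewrite NegzE mulrNz -(pos n.+1) subrK.
Qed.

(** The fractional part v of s - t satisfies cos(2 pi v) = 1. Injectivity of the cosine on [0, pi]
    gives v = 0 when v <= 1/2, and is applied to 1 - v otherwise. *)
Lemma expi_eq s t : expi s = expi t -> exists l : int, s = t + l%:~R.
Proof.
move=> [c1 s1]; exists (Num.floor (s - t)); apply/eqP.
rewrite -subr_eq0 opprD addrA; set v := (_ - _); apply/eqP.
have /andP[v0 v1] : 0 <= v < 1.
  rewrite /v; have := floor_le (s - t); have := floorD1_gt (s - t); rewrite intrD; lra.
have cv : cos (pi *+ 2 * v) = 1.
  have -> : cos (pi *+ 2 * v) = (expi v).1 by [].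
  rewrite /v -mulrNz expiDint /= mulrBr cosB c1 s1 -!expr2.
  exact: cos2Dsin2.
have pi0 := @pi_gt0 R.
have [h|h] := lerP v (1/2).
  have : pi *+ 2 * v = 0.
    apply: cos_inj; rewrite ?cv ?cos0 // !in_itv /=; [|lra].
    by apply/andP; split; nra.
  by move/eqP; rewrite mulf_eq0 => /orP[|/eqP//]; rewrite mulrn_eq0 /= gt_eqF.
have : pi *+ 2 * (1 - v) = 0.
  apply: cos_inj; rewrite ?in_itv /=; [by apply/andP; split; nra|lra|].
  by rewrite cos0 mulrBr mulr1 cosB cos2pi sin2pi mul1r mul0r addr0.
move/eqP; rewrite mulf_eq0 => /orP[|/eqP]; first by rewrite mulrn_eq0 /= gt_eqF.
lra.
Qed.

Lemma expi_surj z : circle z -> exists t, z = expi t.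
Proof.
case: z => x y; rewrite /circle /= => xy.
have x1 : -1 <= x <= 1 by apply/andP; split; nra.
have pi0 : pi *+ 2 != 0 :> R by rewrite mulrn_eq0 /= gt_eqF // pi_gt0.
have yE : `|y| = sin (acos x).
  by rewrite sin_acos // -sqrtr_sqr; congr Num.sqrt; rewrite -xy addrAC subrr add0r.
have [y0|y0] := lerP 0 y.
  exists (acos x / (pi *+ 2)); rewrite /expi mulrC divfK // acosK ?in_itv //.
  by rewrite -yE ger0_norm.
exists (- acos x / (pi *+ 2)); rewrite /expi mulrC divfK // cosN sinN acosK ?in_itv //.
by rewrite -yE ltr0_norm // opprK.
Qed.

Lemma continuous_expi : continuous expi.
Proof.
have cl : continuous (fun t : R => pi *+ 2 * t) := @mulrl_continuous R _.
move=> t; apply: (@cvg_pair _ _ _ _ (nbhs (cos (pi *+ 2 * t))) (nbhs (sin (pi *+ 2 * t)))).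
  exact: continuous_comp (cl t) (@continuous_cos R _).
exact: continuous_comp (cl t) (@continuous_sin R _).
Qed.

(** Openness of the covering: the points of one period around t0 that are at distance at least e
    from t0 have a compact image, which misses [expi t0]. *)
Lemma expi_near t0 (e : R) : 0 < e ->
  \forall z \near expi t0, circle z -> exists2 t, `|t - t0| < e & expi t = z.
Proof.
move=> e0.
pose A := `[t0 - 1/2, t0 + 1/2]%classic `&` ~` ball t0 e.
have cA : compact A.
  apply: (subclosed_compact _ (@segment_compact _ (t0 - 1/2) (t0 + 1/2))).
    apply: closedI; first exact: interval_closed.
    by apply: open_closedC; exact: ball_open.
  by move=> ? [].
have clA : closed (expi @` A).
  apply: compact_closed; first exact: norm_hausdorff.
  apply: continuous_compact cA; exact/continuous_subspaceT/continuous_expi.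
have : nbhs (expi t0) (~` (expi @` A)).
  apply: open_nbhs_nbhs; split; first exact: closed_openC.
  move=> [t [/=]]; rewrite in_itv /= => /andP[l1 l2] nb /expi_eq [l tl]; apply: nb.
  have l0 : l = 0.
    have : (-1 < l%:~R :> R) /\ (l%:~R < 1 :> R) by split; lra.
    rewrite -[1]/(1%:~R) -mulrNz !ltr_int; lia.
  by rewrite /ball /= tl l0 addr0 subrr normr0.
apply: filterS => z nz /expi_surj [t zt].
pose l := Num.floor (t - t0 + 1/2).
exists (t - l%:~R); last by rewrite -mulrNz expiDint.
have h1 := floor_le (t - t0 + 1/2); have := floorD1_gt (t - t0 + 1/2).
rewrite intrD -/l => h2; rewrite -/l in h1.
apply: contrapT => nlt; apply: nz; exists (t - l%:~R); last by rewrite -mulrNz expiDint.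
split; first by rewrite /= in_itv /=; apply/andP; split; lra.
by rewrite /ball /= distrC.
Qed.

Lemma expi_lipschitz (e : R) : 0 < e ->
  exists2 d : R, 0 < d & forall s t, `|s - t| < d -> ball (expi s) e (expi t).
Proof.
move=> e0; have pi0 := @pi_gt0 R.
have lipc (x y : R) : `|cos x - cos y| <= `|x - y|.
  wlog xy : x y / x <= y.
    by move=> H; case: (leP x y) => [|/ltW] /H //; rewrite distrC [X in _ <= X]distrC.
  have [c _] := @MVT_segment R cos (fun x => - sin x) x y xy
    (fun w _ => is_derive_cos w) (continuous_subspaceT (@continuous_cos R)).
  rewrite distrC => ->; rewrite normrM [`|x - y|]distrC -[X in _ <= X]mul1r.
  by rewrite ler_wpM2r // normrN sin_max.
have lips (x y : R) : `|sin x - sin y| <= `|x - y|.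
  by rewrite -!cosBpihalf (le_trans (lipc _ _)) // opprB addrA subrK.
exists (e / (pi *+ 2)) => [|s t st].
  by rewrite divr_gt0 // mulrn_wgt0 // mulr2n addr_gt0.
have st' : `|pi *+ 2 * s - pi *+ 2 * t| < e.
  have p2 : 0 < pi *+ 2 :> R by rewrite mulr2n addr_gt0.
  by rewrite -mulrBr normrM gtr0_norm // mulrC -ltr_pdivlMr.
split; rewrite /ball /=; [exact: le_lt_trans (lipc _ _) _|exact: le_lt_trans (lips _ _) _].
Qed.
End Circle.

(** * Sections of open maps of the interval *)

Section OpenMaps.
Variable R : realType.
Implicit Types (F : R -> R) (x y c u v : R).

(** The retraction onto [0, 1]; composition with it makes maps that matter only on [0, 1] continuous
    on the whole line. *)
Definition clip x : R := Num.max 0 (Num.min 1 x).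

Lemma clip_I x : 0 <= clip x <= 1.
Proof. by rewrite /clip le_max lexx /= ge_max ler01 ge_min lexx. Qed.

Lemma clip_id x : 0 <= x <= 1 -> clip x = x.
Proof. by case/andP=> x0 x1; rewrite /clip min_r // max_r. Qed.

Lemma continuous_clip : continuous clip.
Proof.
move=> x; apply: continuous_max; first exact: cvg_cst.
by apply: continuous_min; [exact: cvg_cst|exact: cvg_id].
Qed.

Lemma continuous_comp_clip F :
  {within `[0, 1], continuous F} -> continuous (F \o clip).
Proof.
move=> /subspace_continuousP cF x W nW.
have /cF /(_ _ nW) : `[0, 1]%classic (clip x) by rewrite /= in_itv /= clip_I.
rewrite /= nbhs_filterE /within /= => /continuous_clip h.
change (nbhs x ((F \o clip) @^-1` W)).
have {}h : nbhs x (clip @^-1` [set z | z \in `[0, 1] -> W (F z)]) by exact: h.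
by apply: filterS h => z; apply; rewrite in_itv /= clip_I.
Qed.

(** Open surjections of [0, 1] as total functions, with openness in pointwise form: all values near
    F x are taken near x. *)
Record fold F : Prop := Fold {
  fold_cont : continuous F;
  fold_I : forall x, 0 <= F x <= 1;
  fold_onto : forall y, 0 <= y <= 1 -> exists2 x, 0 <= x <= 1 & F x = y;
  fold_open : forall x (e : R), 0 <= x <= 1 -> 0 < e ->
    exists2 d : R, 0 < d & forall y, 0 <= y <= 1 -> `|y - F x| < d ->
      exists x', [/\ 0 <= x' <= 1, `|x' - x| < e & F x' = y] }.

Lemma fold_open_surj (f : R -> R) :
  open_surj_I01_map f -> fold (f \o clip).
Proof.
case=> cf sf opf.
have inI x : (0 <= x <= 1) = (x \in `[0, 1]) by rewrite in_itv.
have fI x : 0 <= x <= 1 -> 0 <= f x <= 1.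
  rewrite !inI => xI; have : (f @` I01 (R := R)) (f x) by exists x.
  by rewrite sf.
split=> [x|x|y|x e].
- exact: continuous_comp_clip.
- exact/fI/clip_I.
- move=> yI; have : (f @` I01 (R := R)) y by rewrite sf /I01 /= -inI.
  case=> x; rewrite /I01 /= -inI => xI <-.
  by exists x => //=; rewrite clip_id.
- move=> xI e0; rewrite /= clip_id //.
  have [D [oD fO]] := opf _ (ball_open x e).
  have Dfx : D (f x).
    suff : (D `&` I01 (R := R)) (f x) by case.
    rewrite -fO; exists x => //; split; last by rewrite /I01 /= -inI.
    exact: ballxx.
  have [d /= d0 bd] : nbhs_ball (f x) D by apply/nbhs_ballP; exact: open_nbhs_nbhs.
  exists d => // y yI yd.
  have : (D `&` I01 (R := R)) y.
    by split; [apply: bd; rewrite /ball /= distrC|rewrite /I01 /= -inI].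
  rewrite -fO => -[x' [bx' x'I] <-]; exists x'.
  have x'J : 0 <= x' <= 1 by rewrite inI.
  by split=> //; [rewrite distrC|rewrite clip_id].
Qed.

(** With [foldD], the symmetries that reduce minima to maxima and the left side to the right
    side. *)
Lemma foldC F : fold F -> fold (fun x => 1 - F x).
Proof.
case=> cF IF sF oF; split=> [x|x|y yI|x e xI e0].
- by apply: cvgB; [exact: cvg_cst|exact: cF].
- by have := IF x; lra.
- by have [|x xI Fx] := sF (1 - y); [lra|exists x => //; lra].
- have [d d0 h] := oF x e xI e0; exists d => // y yI yd.
  have [||x' [x'I x'e Fx']] := h (1 - y); first lra.
    by rewrite distrC (_ : F x - (1 - y) = y - (1 - F x)) //; lra.
  by exists x'; split=> //; lra.
Qed.

Lemma foldD F : fold F -> fold (fun x => F (1 - x)).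
Proof.
case=> cF IF sF oF; split=> [x|x|y yI|x e xI e0].
- apply: (@continuous_comp _ _ _ (fun x : R => 1 - x) F); last exact: cF.
  by apply: cvgB; [exact: cvg_cst|exact: cvg_id].
- exact: IF.
- have [x xI Fx] := sF y yI; exists (1 - x); first lra.
  by rewrite subKr.
- have [|d d0 h] := oF (1 - x) e _ e0; first lra.
  exists d => // y yI yd; have [x' [x'I x'e Fx']] := h y yI yd.
  exists (1 - x'); split; first lra.
    by rewrite distrC (_ : x - (1 - x') = x' - (1 - x)) //; lra.
  by rewrite subKr.
Qed.

(** By openness, values slightly above F x are taken near x unless F x is already 1. *)
Lemma fold_locmax F x (e : R) : fold F -> 0 <= x <= 1 -> 0 < e ->
  (forall t, 0 <= t <= 1 -> `|t - x| < e -> F t <= F x) -> F x = 1.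
Proof.
move=> fF xI e0 mx; have [d d0 h] := fold_open fF xI e0.
have /andP[Fx0 Fx1] := fold_I fF x.
apply/eqP; rewrite eq_le Fx1 /= leNgt; apply/negP => lt1.
pose y := Num.min 1 (F x + d / 2).
have yx : F x < y by rewrite lt_min lt1 /=; lra.
have [||x' [x'I x'e Fx']] := h y.
- by rewrite (le_trans Fx0 (ltW yx)) /= ge_min lexx.
- by rewrite ger0_norm ?subr_ge0 ?(ltW yx) // ltrBlDl gt_min; apply/orP; right; lra.
by have := mx x' x'I x'e; rewrite Fx' leNgt yx.
Qed.

Lemma fold_locmin F x (e : R) : fold F -> 0 <= x <= 1 -> 0 < e ->
  (forall t, 0 <= t <= 1 -> `|t - x| < e -> F x <= F t) -> F x = 0.
Proof.
move=> fF xI e0 mn; have /= := fold_locmax (foldC fF) xI e0.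
by move=> H; have : 1 - F x = 1 by [apply: H => t tI te; have := mn t tI te; lra]; lra.
Qed.

Lemma first_zero F a b : continuous F -> a <= b -> F b = 0 ->
  exists v, [/\ a <= v <= b, F v = 0 & forall t, a <= t <= b -> F t = 0 -> v <= t].
Proof.
move=> cF ab Fb; pose A := `[a, b]%classic `&` F @^-1` [set 0].
have cA : compact A.
  apply: (subclosed_compact _ (@segment_compact _ a b)); last by move=> ? [].
  apply: closedI; first exact: interval_closed.
  by apply: closed_comp => [x _|]; [exact: cF|exact: closed_eq].
have cid : continuous (id : R -> R) by move=> x; exact: cvg_id.
have [|v] := compact_EVT_min _ cA (continuous_subspaceT cid).
  by exists b; split => //=; rewrite in_itv /= ab lexx.
rewrite inE => -[/= vI Fv] mn; exists v; split=> // t tI Ft.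
by apply: mn; rewrite inE; split=> //=; rewrite in_itv.
Qed.

Lemma last_zero F a b : continuous F -> a <= b -> F a = 0 ->
  exists v, [/\ a <= v <= b, F v = 0 & forall t, a <= t <= b -> F t = 0 -> t <= v].
Proof.
move=> cF ab Fa.
have [|||v [vI Fv mx]] := @first_zero (fun x => F (- x)) (- b) (- a).
- by move=> x; apply: (@continuous_comp _ _ _ (fun x : R => - x) F); [exact: oppr_continuous|exact: cF].
- by rewrite lerN2.
- by rewrite opprK.
exists (- v); split=> // [|t tI Ft]; first by lra.
by have := mx (- t); rewrite opprK => /(_ _ Ft); lra.
Qed.

Lemma segment_max F a b : continuous F -> a <= b ->
  exists2 m, a <= m <= b & forall t, a <= t <= b -> F t <= F m.
Proof.
move=> cF ab; have [m mI mx] := EVT_max ab (continuous_subspaceT cF).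
by exists m => [|t tI]; [move: mI; rewrite in_itv|apply: mx; rewrite in_itv].
Qed.

Lemma segment_min F a b : continuous F -> a <= b ->
  exists2 m, a <= m <= b & forall t, a <= t <= b -> F m <= F t.
Proof.
move=> cF ab; have [m mI mx] := EVT_min ab (continuous_subspaceT cF).
by exists m => [|t tI]; [move: mI; rewrite in_itv|apply: mx; rewrite in_itv].
Qed.

Let near_in (p q m t : R) : p < m < q -> `|t - m| < Num.min (m - p) (q - m) ->
  p <= t <= q.
Proof. by move=> pmq; rewrite lt_min !ltr_norml; lra. Qed.

Lemma fold_intmax F p q m : fold F -> 0 <= p -> q <= 1 -> p < m < q ->
  (forall t, p <= t <= q -> F t <= F m) -> F m = 1.
Proof.
move=> fF p0 q1 pmq mx.
apply: (@fold_locmax _ _ (Num.min (m - p) (q - m)) fF) => [||t _ /(near_in pmq) /mx //].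
  lra.
by rewrite lt_min; lra.
Qed.

Lemma fold_intmin F p q m : fold F -> 0 <= p -> q <= 1 -> p < m < q ->
  (forall t, p <= t <= q -> F m <= F t) -> F m = 0.
Proof.
move=> fF p0 q1 pmq mx.
apply: (@fold_locmin _ _ (Num.min (m - p) (q - m)) fF) => [||t _ /(near_in pmq) /mx //].
  lra.
by rewrite lt_min; lra.
Qed.

(** A form of Rolle's lemma: some interior point is extremal over [p, q], and openness forces the
    value 0 or 1 there. The vanishing product encodes these two values. *)
Lemma fold_intext F p q : fold F -> 0 <= p -> p < q -> q <= 1 -> F p = F q ->
  exists2 t, p < t < q & F t * (1 - F t) = 0.
Proof.
move=> fF p0 pq q1 Fpq; have cF := fold_cont fF.
have [M MI mx] := segment_max cF (ltW pq).
have [m mI mn] := segment_min cF (ltW pq).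
have [FM|FM] := eqVneq (F M) (F p); last first.
  have pMq : p < M < q.
    case/andP: MI => h1 h2; rewrite !lt_neqAle h1 h2 !andbT.
    apply/andP; split; [apply: contraNneq FM => -> //|].
    by apply: contraNneq FM => ->; rewrite Fpq.
  by exists M => //; rewrite (fold_intmax fF p0 q1 pMq mx) subrr mulr0.
have [Fm|Fm] := eqVneq (F m) (F p); last first.
  have pmq : p < m < q.
    case/andP: mI => h1 h2; rewrite !lt_neqAle h1 h2 !andbT.
    apply/andP; split; [apply: contraNneq Fm => -> //|].
    by apply: contraNneq Fm => ->; rewrite Fpq.
  by exists m => //; rewrite (fold_intmin fF p0 q1 pmq mn) mul0r.
have cst t : p <= t <= q -> F t = F p.
  by move=> tI; apply/eqP; rewrite eq_le -{1}FM -Fm mx //= mn.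
have mid : p < (p + q) / 2 < q by lra.
exists ((p + q) / 2) => //; rewrite (fold_intmax fF p0 q1 mid) ?subrr ?mulr0 //.
by move=> t tI; rewrite !cst //; lra.
Qed.

(** This shows that end points go to 0 or 1. Here v is the first point of value 0 or 1; the minimum
    over [0, v] is attained before v, so it is a local minimum in [0, 1] and equals 0, against the
    choice of v. *)
Let fold_end_aux F v : fold F -> 0 < F 0 -> F 0 < 1 -> 0 <= v <= 1 -> F v = 1 ->
  (forall t, 0 <= t <= v -> F t * (1 - F t) = 0 -> v <= t) -> False.
Proof.
move=> fF F00 F01 /andP[v0 v1] Fv fst.
have [m mI mn] := segment_min (fold_cont fF) v0.
have Fm : F m <= F 0 by apply: mn; rewrite lexx.
have mv : m < v.
  case/andP: mI => _ h; rewrite lt_neqAle h andbT; apply/eqP => mv.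
  by move: Fm; rewrite mv Fv; lra.
have Fm0 : F m = 0.
  apply: (@fold_locmin _ _ (v - m) fF); [lra|lra|move=> t tI].
  by rewrite ltr_norml => h; apply: mn; lra.
by have := fst m mI; rewrite Fm0 mul0r => /(_ erefl); lra.
Qed.

Lemma fold_end0 F : fold F -> F 0 * (1 - F 0) = 0.
Proof.
move=> fF; apply/eqP/negPn/negP => ne.
have [F00 F01] : 0 < F 0 /\ F 0 < 1.
  move: ne; rewrite mulf_eq0 negb_or subr_eq0 => /andP[n0 n1].
  by have /andP[h0 h1] := fold_I fF 0; rewrite !lt_neqAle h0 h1 eq_sym n0 eq_sym n1.
have [x xI Fx] := fold_onto fF (y := 0) ltac:(by rewrite lexx ler01).
have [|||v [vI Fv fst]] := @first_zero (fun t => F t * (1 - F t)) 0 x.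
- move=> t; apply: cvgM; first exact: fold_cont.
  by apply: cvgB; [exact: cvg_cst|exact: fold_cont].
- by case/andP: xI.
- by rewrite Fx mul0r.
have vI' : 0 <= v <= 1 by lra.
have fst' t : 0 <= t <= v -> F t * (1 - F t) = 0 -> v <= t.
  by move=> tI; apply: fst; lra.
move/eqP: Fv; rewrite mulf_eq0 subr_eq0 => /orP[]/eqP Fv; last first.
  exact: (fold_end_aux fF F00 F01 vI' (esym Fv) fst').
apply: (fold_end_aux (foldC fF) _ _ vI'); rewrite ?Fv; try lra.
by move=> t tI; rewrite subKr mulrC; exact: fst'.
Qed.

Lemma fold_end1 F : fold F -> F 1 * (1 - F 1) = 0.
Proof. by move=> /foldD /fold_end0; rewrite subr0. Qed.

(** A lap of F through c: a continuous F maps [u, v] onto [0, 1], and the inverse of this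
    restriction is a section through c. *)
Definition branch F c u v :=
  [/\ 0 <= u <= c, c <= v <= 1,
      forall p q, u <= p <= v -> u <= q <= v -> F p = F q -> p = q &
      F u = 0 /\ F v = 1 \/ F u = 1 /\ F v = 0].

Let inj_branch F u v :
  (forall p q, u <= p -> p < q -> q <= v -> F p <> F q) ->
  forall p q, u <= p <= v -> u <= q <= v -> F p = F q -> p = q.
Proof.
move=> ne p q /andP[p1 p2] /andP[q1 q2] Fpq.
have [pq|qp|->//] := ltgtP p q; first by case: (ne p q p1 pq q2).
by case: (ne q p q1 qp p2).
Qed.

(** Take for v the first point after c of value 1. If F p = F q with p < q in [c, v], [fold_intext]
    gives a zero t of F between them, and an interior maximum over [c, t] would have value 1 before
    v. *)
Let branch_bot F c r : fold F -> 0 <= c -> F c = 0 -> c <= r <= 1 -> F r = 1 ->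
  exists v, branch F c c v.
Proof.
move=> fF c0 Fc /andP[cr r1] Fr; have cF := fold_cont fF.
have [|||v [/andP[cv vr] Fv fst]] := @first_zero (fun t => F t - 1) c r.
- by move=> t; apply: cvgB; [exact: cF|exact: cvg_cst].
- by [].
- by rewrite Fr subrr.
have {}Fv : F v = 1 by lra.
have fst1 t : c <= t < v -> F t <> 1.
  move=> tI Ft; have : v <= t by apply: fst; [lra|rewrite Ft subrr].
  by lra.
exists v; split; [lra|lra| |by left].
apply: inj_branch => p q cp pq qv Fpq.
have [||||t /andP[pt tq] Ft] := @fold_intext F p q fF; try lra.
have {}Ft : F t = 0.
  move/eqP: Ft; rewrite mulf_eq0 subr_eq0 => /orP[/eqP//|/eqP Ft].
  by case: (@fst1 t); [lra|].
have ct : c < t by lra.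
have [m /andP[cm mt] mx] := segment_max cF (ltW ct).
(* If the maximum is at an end, F vanishes on [c, t] and the midpoint is a maximum too. *)
have [m' [cm't mx']] : exists m', c < m' < t /\ forall s, c <= s <= t -> F s <= F m'.
  have [/andP h|h] := boolP ((c < m) && (m < t)).
    by exists m; split=> //; apply/andP.
  have Fm : F m = 0.
    move: h; rewrite negb_and -!leNgt => /orP[h|h].
      by rewrite (_ : m = c) //; lra.
    by rewrite (_ : m = t) //; lra.
  exists ((c + t) / 2); split; first lra.
  by move=> s /mx; rewrite Fm => /le_trans; apply; case/andP: (fold_I fF ((c + t) / 2)).
by case: (@fst1 m'); [lra|apply: (fold_intmax fF c0 _ cm't mx'); lra].
Qed.

Lemma branchC F c u v : branch (fun x => 1 - F x) c u v -> branch F c u v.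
Proof.
case=> uc cv inj ends; split=> // [p q pI qI Fpq|].
  by apply: inj => //; rewrite Fpq.
by case: ends => -[h1 h2]; [right|left]; split; lra.
Qed.

Lemma branchD F c u v : branch (fun x => F (1 - x)) c u v ->
  branch F (1 - c) (1 - v) (1 - u).
Proof.
case=> uc cv inj ends; split; [lra|lra| |by case: ends => -[h1 h2]; [right|left]].
move=> p q pI qI Fpq; have : 1 - p = 1 - q; last lra.
by apply: inj; rewrite ?subKr //; lra.
Qed.

(** If F c is 0 or 1, the lap goes from c towards a point of the opposite value. Otherwise it
    extends to the nearest points of value 0 or 1 on both sides, and [fold_intext] makes F injective
    between them. *)
Lemma fold_branch F c : fold F -> 0 <= c <= 1 -> exists u v, branch F c u v.
Proof.
move=> fF cI.
have bot G b : fold G -> 0 <= b <= 1 -> G b = 0 -> exists u v, branch G b u v.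
  move=> fG /andP[b0 b1] Gb.
  have [r /andP[r0 r1] Gr] := fold_onto fG (y := 1) ltac:(by rewrite lexx ler01).
  have [br|/ltW rb] := leP b r.
    by have [|v Bv] := branch_bot fG b0 Gb _ Gr; [rewrite br|exists b, v].
  have [||||v Bv] := branch_bot (foldD fG) (c := 1 - b) (r := 1 - r); try lra.
  - by rewrite subKr.
  - by rewrite subKr.
  exists (1 - v), (1 - (1 - b)); have := branchD Bv.
  by rewrite (_ : 1 - (1 - b) = b) //; lra.
have [/eqP|ne] := eqVneq (F c * (1 - F c)) 0.
  rewrite mulf_eq0 subr_eq0 => /orP[/eqP|/eqP] Fc; first exact: bot.
  have [|u [v B]] := bot _ _ (foldC fF) cI; first by rewrite -Fc subrr.
  by exists u, v; apply: branchC.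
have cG : continuous (fun t => F t * (1 - F t)).
  move=> t; apply: cvgM; first exact: fold_cont.
  by apply: cvgB; [exact: cvg_cst|exact: fold_cont].
case/andP: (cI) => c0 c1.
have [u [uI Fu lst]] := last_zero cG c0 (fold_end0 fF).
have [v [vI Fv fst]] := first_zero cG c1 (fold_end1 fF).
have uc : u != c by apply: contraNneq ne => <-; rewrite Fu.
have cv : c != v by apply: contraNneq ne => ->; rewrite Fv.
have {}uc : u < c by rewrite lt_neqAle uc; case/andP: uI.
have {}cv : c < v by rewrite lt_neqAle cv; case/andP: vI.
have inj : forall p q, u <= p <= v -> u <= q <= v -> F p = F q -> p = q.
  apply: inj_branch => p q up pq qv Fpq.
  have [||||t /andP[pt tq] Ft] := @fold_intext F p q fF; try lra.
  have [tc|/ltW ct] := leP t c.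
    by have := lst t _ Ft; lra.
  by have := fst t _ Ft; lra.
exists u, v; split; [lra|lra|exact: inj|].
have Fuv : F u <> F v by move=> /inj; rewrite !lexx; lra.
move/eqP: Fu; rewrite mulf_eq0 subr_eq0 => /orP[]/eqP Fu;
  move/eqP: Fv; rewrite mulf_eq0 subr_eq0 => /orP[]/eqP Fv.
- by case: Fuv; rewrite Fu Fv.
- by left.
- by right.
- by case: Fuv; rewrite -Fu -Fv.
Qed.

Lemma fold_section F c : fold F -> 0 <= c <= 1 ->
  exists s : R -> R, [/\ continuous s, forall a, 0 <= s a <= 1,
    forall a, 0 <= a <= 1 -> F (s a) = a & s (F c) = c].
Proof.
move=> fF cI; have [u [v [uc cv inj ends]]] := fold_branch fF cI.
have uv : u <= v by lra.
(* The default c is never taken for y in [0, 1], by [onto]. *)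
pose g y := xget c [set x | u <= x <= v /\ F x = y].
have gK : {in `[u, v], cancel F g}.
  move=> x; rewrite in_itv /= => xI; rewrite /g; case: xgetP => [y _ [yI]|/(_ x)].
    exact: inj.
  by case.
have onto y : 0 <= y <= 1 -> exists2 x, u <= x <= v & F x = y.
  move=> yI; have [|x xI Fx] := @IVT R F u v y uv (continuous_subspaceT (fold_cont fF)).
    by case: ends => -[-> ->]; [rewrite min_l ?max_r|rewrite min_r ?max_l].
  by exists x => //; move: xI; rewrite in_itv.
have gI y : 0 <= y <= 1 -> u <= g y <= v.
  by case/onto => x xI <-; rewrite gK // in_itv.
have cg : {within `[0, 1], continuous g}.
  case: ends => -[Fu Fv].
    by have := segment_can_le_continuous uv (continuous_subspaceT (fold_cont fF)) gK; rewrite Fu Fv.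
  by have := segment_can_ge_continuous uv (continuous_subspaceT (fold_cont fF)) gK; rewrite Fu Fv.
exists (g \o clip); split=> [|a|a aI|] /=.
- exact: continuous_comp_clip.
- by have := gI _ (clip_I a); lra.
- by rewrite clip_id //; have [x xI <-] := onto a aI; rewrite gK // in_itv.
- by rewrite clip_id ?fold_I // gK // in_itv /=; lra.
Qed.

(** Levels below m are determined by level m; those above are chosen by sections of [f i] through
    [x i.+1]. The induction on m strips off level 0. *)
Lemma inverse_limit_section (f : nat -> R -> R) (m : nat) (x : nat -> R) :
  (forall i, open_surj_I01_map (f i)) -> arc_inverse_limit f x ->
  exists s : R -> nat -> R, [/\ forall i, continuous (s ^~ i),
    forall a, arc_inverse_limit f (s a), forall a, s a m = clip a & s (x m) = x].
Proof.
elim: m f x => [|m IH] f x of_ xL.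
  have xI i : 0 <= x i <= 1.
    by have [+ _] := xL i; rewrite /I01 /= in_itv.
  have [sg sgP] := choice (fun i => fold_section (fold_open_surj (of_ i)) (xI i.+1)).
  pose s a := fix s i := if i is j.+1 then sg j (s j) else clip a.
  have sI a i : 0 <= s a i <= 1.
    by case: i => [|i] /=; [exact: clip_I|have [_ + _ _] := sgP i].
  exists s; split=> [i|a i|a|] //.
  - elim: i => [|i IHi] /=; first exact: continuous_clip.
    by move=> a; apply: (@continuous_comp _ _ _ (s ^~ i) (sg i)); [exact: IHi|have [+ _ _ _] := sgP i; apply].
  - split; first by rewrite /I01 /= in_itv sI.
    by have [_ h1 h2 _] := sgP i; rewrite -[LHS](h2 _ (sI a i)) /= clip_id.
  - apply/funext; elim=> [|i IHi] /=; first by rewrite clip_id.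
    rewrite IHi; have [_ _ _ h] := sgP i.
    by rewrite -[RHS]h /= clip_id //; have [_ <-] := xL i.
have [||s [cs sL sm sx]] := IH (fun i => f i.+1) (fun i => x i.+1).
- by move=> i; exact: of_.
- by move=> i; exact: xL.
have sI a i : 0 <= s a i <= 1 by have [+ _] := sL a i; rewrite /I01 /= in_itv.
exists (fun a i => if i is j.+1 then s a j else f 0%N (s a 0%N)); split.
- case=> [|i]; last exact: cs.
  rewrite (_ : (fun a => _) = (f 0%N \o clip) \o (s ^~ 0%N)).
    move=> a; apply: continuous_comp; first exact: cs.
    exact: fold_cont (fold_open_surj (of_ 0%N)) _.
  by apply/funext => a /=; rewrite clip_id.
- move=> a [|i]; last exact: sL.
  split=> //; have := fold_I (fold_open_surj (of_ 0%N)) (s a 0%N).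
  by rewrite /= clip_id // /I01 /= in_itv.
- exact: sm.
- by apply/funext => -[|i]; rewrite sx //; have [_ <-] := xL 0%N.
Qed.

End OpenMaps.

(** * Leaves of solenoids and coordinates on inverse limits *)

Section Solenoid.
Variables (R : realType) (n : nat -> nat).
Hypothesis n2 : forall i, (2 <= n i)%N.
Implicit Types (y z : nat -> (R * R)%type).
Notation L := (@circle_inverse_limit R n).

(** The degree of the composite bonding map from level m + r to level m. *)
Definition span m r : nat := \prod_(j < r) n (m + j).

Lemma spanS m r : span m r.+1 = (span m r * n (m + r))%N.
Proof. by rewrite /span big_ord_recr. Qed.

Lemma span_gt m r : (r < span m r)%N.
Proof.
elim: r => [|r IH]; first by rewrite /span big_ord0.
by rewrite spanS; have := n2 (m + r); nia.
Qed.

Lemma span_cat m r s : span m (r + s) = (span m r * span (m + r) s)%N.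
Proof.
elim: s => [|s IH]; first by rewrite addn0 [in RHS]/span big_ord0 muln1.
by rewrite addnS !spanS IH mulnA addnA.
Qed.

Lemma limit_coord y m r (t : R) :
  L y -> y (m + r)%N = expi t -> y m = expi ((span m r)%:R * t).
Proof.
move=> yL; elim: r t => [|r IH] t; first by rewrite addn0 /span big_ord0 mul1r.
rewrite addnS => yt; rewrite spanS natrM -mulrA; apply: IH.
by have [_ ->] := yL (m + r)%N; rewrite yt cpow_expi.
Qed.

(** The leaf through y, parametrized by the angle at level m. It returns to the same fiber after
    each turn, and the right number of turns matches z at level m + N, hence at all levels up to
    N. *)
Lemma limit_leaf y m (th : R) : L y -> y m = expi th ->
  exists h : R -> nat -> (R * R)%type,
  [/\ forall i, continuous (h ^~ i), forall t, L (h t), forall t, h t m = expi t,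
      h th = y &
      forall z (t : R), L z -> z m = expi t -> forall N, exists l : int,
        forall i, (i <= N)%N -> h (t + l%:~R) i = z i].
Proof.
move=> yL ym.
have [a ya] := choice (fun i => expi_surj (yL i).1).
(* The angular speed at level i for speed 1 at level m; [cS] is its compatibility with the bonding
   maps. *)
pose c i : R := (span 0 m)%:R / (span 0 i)%:R.
have s0 k r : (span k r)%:R != 0 :> R by rewrite pnatr_eq0 -lt0n (leq_ltn_trans _ (span_gt _ _)).
have cS i : c i = (n i)%:R * c i.+1.
  rewrite /c spanS add0n natrM; have ni : (n i)%:R != 0 :> R.
    by rewrite pnatr_eq0; have := n2 i; case: (n i).
  by field; rewrite ni s0.
pose h t i := expi (a i + c i * (t - th)).
have hL t : L (h t).
  move=> i; split; first exact: circle_expi.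
  have [_] := yL i; rewrite /h !ya !cpow_expi => /expi_eq[l ->].
  by rewrite cS addrAC expiDint; congr expi; ring.
have am : exists l : int, a m = th + l%:~R by apply: expi_eq; rewrite -ya.
exists h; split=> //.
- move=> i t; apply: (@continuous_comp _ _ _ (fun t => a i + c i * (t - th)) (@expi R)).
    apply: cvgD; first exact: cvg_cst.
    apply: cvgM; first exact: cvg_cst.
    by apply: cvgB; [exact: cvg_id|exact: cvg_cst].
  exact: continuous_expi.
- move=> t; rewrite /h /c divff // mul1r; have [l ->] := am.
  by rewrite addrAC expiDint addrC subrK.
- by apply/funext => i; rewrite /h subrr mulr0 addr0 -ya.
move=> z t zL zm N.
have [b zb] := expi_surj (zL (m + N)%N).1.
have := limit_coord zL zb; rewrite zm => /expi_eq[l1 tE].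
have := limit_coord yL (ya (m + N)%N); rewrite ym => /expi_eq[l2 thE].
exists (l2 - l1) => i iN.
have hz : h (t + (l2 - l1)%:~R) (m + N)%N = z (m + N)%N.
  rewrite zb /h; congr expi; rewrite tE thE /c span_cat add0n natrM intrB.
  by have := s0 0%N m; have := s0 m N; move=> h1 h2; field; rewrite h1.
have [k ik] : exists k, (m + N = i + k)%N by exists (m + N - i)%N; lia.
rewrite ik in hz zb.
by rewrite (limit_coord zL zb) (limit_coord (hL _) (etrans hz zb)).
Qed.

End Solenoid.

Section Coordinates.
Variables (R : realType) (T : pseudoMetricType R).

(** A single N bounds the coordinates and gives their precision, so that the sets [B N] form a
    filter base. It converges to f in the initial topology of each coordinate, hence in their
    supremum. *)
Lemma nbhs_ptws (f : {ptws nat -> T}) (W : set {ptws nat -> T}) : nbhs f W ->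
  exists N, forall u : nat -> T,
    (forall i, (i <= N)%N -> ball (f i) N.+1%:R^-1 (u i)) -> W u.
Proof.
pose B N := [set u : {ptws nat -> T} |
  forall i, (i <= N)%N -> ball (f i) N.+1%:R^-1 (u i)].
have mono (N M : nat) : (N <= M)%N -> M.+1%:R^-1 <= N.+1%:R^-1 :> R.
  by move=> NM; rewrite lef_pV2 ?posrE ?ltr0n // ler_nat.
have FF : Filter (filter_from setT B).
  apply: filter_from_filter; first by exists 0%N.
  move=> N M _ _; exists (maxn N M) => // u Bu; split=> i iN.
    apply: (le_ball (mono _ _ (leq_maxl N M))); apply: Bu.
    by rewrite leq_max iN.
  apply: (le_ball (mono _ _ (leq_maxr N M))); apply: Bu.
  by rewrite leq_max iN orbT.
suff : filter_from setT B --> f by move=> /[apply] -[N _ BW]; exists N => u /BW.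
apply/cvg_sup => i U [V] [[V'] oV <-] Vf VU.
apply: (filterS VU).
have [e /= e0 eV] : nbhs_ball (f i) V' by apply/nbhs_ballP; exact: open_nbhs_nbhs.
have [N Ne] : exists N : nat, N.+1%:R^-1 < e.
  exists (Num.truncn e^-1); rewrite invf_plt ?posrE ?ltr0n //.
  exact: truncnS_gt.
exists (maxn i N) => // u Bu; apply: eV.
apply: (le_ball (ltW (le_lt_trans (mono _ _ (leq_maxr i N)) Ne))).
by apply: Bu; exact: leq_maxl.
Qed.

Lemma homeomorphic_coordinates (X : topologicalType) (L : set {ptws nat -> T}) :
  homeomorphic_to_subspace X L ->
  exists xi : X -> nat -> T,
  [/\ injective xi, forall i, continuous (xi ^~ i),
      forall x O, nbhs x O -> exists N, forall x',
        (forall i, (i <= N)%N -> ball (xi x i) N.+1%:R^-1 (xi x' i)) -> O x',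
      forall x, L (xi x) & forall u, L u -> exists x, xi x = u].
Proof.
case=> h [g [ch cg hL gh hg]]; exists h; split=> //.
- exact: can_inj gh.
- move=> i x; apply: (@continuous_comp _ {ptws nat -> T} _ h (fun u => u i)); first exact: ch.
  exact: (@proj_continuous nat (fun _ => T) i).
- move=> x O nO; have /subspace_continuousP cg' := cg.
  have /(cg' _ (hL x)) : nbhs (g (h x)) O by rewrite gh.
  rewrite /= nbhs_filterE /within /= => /nbhs_ptws[N HN].
  by exists N => x' /HN H; rewrite -(gh x'); exact: H (hL x').
- by move=> u Lu; exists (g u); exact: hg.
Qed.

End Coordinates.

(** * Neighborhoods of compact sets *)

Lemma near_upto (T : Type) (F : set_system T) (P : nat -> T -> Prop) N :
  Filter F -> (forall i, \forall x \near F, P i x) ->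
  \forall x \near F, forall i, (i <= N)%N -> P i x.
Proof.
move=> FF nP; elim: N => [|N IH].
  by apply: filterS (nP 0%N) => x Px i; rewrite leqn0 => /eqP->.
apply: filterS2 IH (nP N.+1) => x h1 h2 i.
by rewrite leq_eqVlt => /predU1P[->//|/h1].
Qed.

Section UniformContinuity.
Variable R : realType.

Lemma segment_unif_continuous (F : R -> R) (a b e : R) : continuous F -> 0 < e ->
  exists2 d : R, 0 < d & forall x y, a <= x <= b -> `|x - y| < d -> `|F x - F y| < e.
Proof.
move=> cF e0; have e20 : 0 < e / 2 by lra.
have /compact_near_coveringP cov := @segment_compact R a b.
have [|d [d0 H]] := filter_ex (filterI (@nbhs_right_gt R 0)
  (cov _ _ (fun (d : R) x => forall y, `|x - y| < d -> `|F x - F y| < e) (at_right_proper_filter _) _)).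
  move=> x _; have /cvgrPdist_lt /(_ _ e20) := cF x.
  rewrite -nbhs_nearE => /nbhs_ballP[d /= d0 hd].
  exists (ball x (d / 2), [set d' | 0 < d' < d / 2]) => /=.
    split; first by apply/nbhs_ballP; exists (d / 2) => //=; lra.
    near=> d'; apply/andP; split; [by near: d'; exact: nbhs_right_gt|].
    by near: d'; apply: nbhs_right_lt; lra.
  move=> [z d'] /= [zx /andP[_ d'd]] y zy.
  have h1 : `|F x - F z| < e / 2.
    by apply: hd; apply: le_ball zx; lra.
  have h2 : `|F x - F y| < e / 2.
    have zx' : `|x - z| < d / 2 := zx.
    by apply: hd; change (`|x - y| < d); have := ler_distD z x y; lra.
  by have := ler_distD (F x) (F z) (F y); rewrite (distrC (F z) (F x)); lra.
by exists d => // x y xI; apply: H; rewrite /= in_itv.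
Unshelve. all: by end_near. Qed.

(** The bonding maps are uniformly continuous, so closeness at one level controls all the levels
    below. *)
Lemma arc_limit_unif (f : nat -> R -> R) (e : R) N :
  (forall i, open_surj_I01_map (f i)) -> 0 < e ->
  exists2 d : R, 0 < d & forall x y, arc_inverse_limit f x -> arc_inverse_limit f y ->
    `|x N - y N| < d -> forall i, (i <= N)%N -> `|x i - y i| < e.
Proof.
move=> of_ e0; elim: N => [|N [d d0 IH]].
  by exists e => // x y _ _ xy i; rewrite leqn0 => /eqP->.
have [d' d'0 H] := @segment_unif_continuous (f N \o clip (R := R)) 0 1 d
  (fold_cont (fold_open_surj (of_ N))) d0.
exists (Num.min e d') => [|x y xL yL]; first by rewrite lt_min e0.
have I (z : nat -> R) i : arc_inverse_limit f z -> 0 <= z i <= 1.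
  by move=> /(_ i)[+ _]; rewrite /I01 /= in_itv.
rewrite lt_min => /andP[xy1 xy2] i; rewrite leq_eqVlt => /predU1P[->//|].
apply: IH => //; rewrite (xL N).2 (yL N).2.
by have := H _ _ (I _ _ xL) xy2; rewrite /= !clip_id ?I.
Qed.

Lemma circle_limit_unif (n : nat -> nat) (e : R) N :
  (forall i, (2 <= n i)%N) -> 0 < e ->
  exists2 d : R, 0 < d & forall x y, circle_inverse_limit n x ->
    circle_inverse_limit n y -> forall a b : R, x N = expi a -> y N = expi b ->
    `|a - b| < d -> forall i, (i <= N)%N -> ball (x i) e (y i).
Proof.
move=> n2 e0; have [d d0 H] := expi_lipschitz e0.
have s0 : 0 < (span n 0 N)%:R :> R by rewrite ltr0n (leq_ltn_trans _ (span_gt n2 0 N)).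
(* Descending from level N multiplies angles by at most [span n 0 N]. *)
exists (d / (span n 0 N)%:R) => [|x y xL yL a b xa yb ab i iN].
  by rewrite divr_gt0.
have [k Nk] : exists k, N = (i + k)%N by exists (N - i)%N; lia.
rewrite Nk in xa yb; rewrite (limit_coord xL xa) (limit_coord yL yb); apply: H.
rewrite -mulrBr normrM ger0_norm //; move: ab; rewrite ltr_pdivlMr // mulrC.
apply: le_lt_trans; rewrite ler_wpM2r // ler_nat Nk span_cat add0n.
by apply: leq_pmull; rewrite (leq_ltn_trans _ (span_gt n2 0 i)).
Qed.

End UniformContinuity.

Section Coord.
Variables (R : realType) (T : pseudoMetricType R) (X : topologicalType).
Variable xi : X -> nat -> T.

Definition basic_coords := forall x O, nbhs x O -> exists N, forall x',
  (forall i, (i <= N)%N -> ball (xi x i) N.+1%:R^-1 (xi x' i)) -> O x'.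

Lemma continuous_coords (Y : topologicalType) (s : Y -> X) : basic_coords ->
  (forall i, continuous (fun a => xi (s a) i)) -> continuous s.
Proof.
move=> bas cs a O /bas[N HN].
have N0 : 0 < N.+1%:R^-1 :> R by rewrite invr_gt0 ltr0n.
suff : \forall b \near a, forall i, (i <= N)%N ->
    ball (xi (s a) i) N.+1%:R^-1 (xi (s b) i) by apply: filterS => b /HN.
apply: near_upto => i; apply: cs; exact: nbhsx_ballx.
Qed.

End Coord.

Section Tube.
Variables (R : realType) (T1 T2 : pseudoMetricType R) (K S : topologicalType).
Variables (xi : K -> nat -> T1) (ze : S -> nat -> T2).
Hypothesis cxi : forall i, continuous (xi ^~ i).
Hypothesis cze : forall i, continuous (ze ^~ i).
Hypothesis bxi : basic_coords xi.
Hypothesis bze : basic_coords ze.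

Let half_close (T : pseudoMetricType R) (X : topologicalType) (c : X -> nat -> T) x N :
  (forall i, continuous (c ^~ i)) ->
  nbhs x [set x' | forall M y, (2 * N.+1 <= M)%N ->
    (forall i, (i <= M)%N -> ball (c x' i) M.+1%:R^-1 (c y i)) ->
    forall i, (i <= N)%N -> ball (c x i) N.+1%:R^-1 (c y i)].
Proof.
move=> cc.
have N0 : 0 < (2 * N.+1)%:R^-1 :> R by rewrite invr_gt0 ltr0n muln_gt0.
have : \forall x' \near x, forall i, (i <= N)%N -> ball (c x i) (2 * N.+1)%:R^-1 (c x' i).
  by apply: near_upto => i; apply: cc; exact: nbhsx_ballx.
apply: filterS => x' h M y NM hM i iN.
rewrite (_ : N.+1%:R^-1 = (2 * N.+1)%:R^-1 + (2 * N.+1)%:R^-1); last first.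
  by rewrite natrM; field.
apply: ball_triangle (h i iN) _; apply: le_ball (hM i _); last by lia.
by rewrite lef_pV2 ?posrE ?ltr0n ?muln_gt0 // ler_nat leqW.
Qed.

(** A Lebesgue number: twice the precision leaves room for moving the center q a little, and
    compactness of M then makes N uniform. *)
Lemma compact_tube (M U : set (K * S)) : compact M -> open U -> M `<=` U ->
  exists N, forall p q, M q ->
    (forall i, (i <= N)%N -> ball (xi q.1 i) N.+1%:R^-1 (xi p.1 i)) ->
    (forall i, (i <= N)%N -> ball (ze q.2 i) N.+1%:R^-1 (ze p.2 i)) -> U p.
Proof.
move=> /compact_near_coveringP cov oU MU.
pose P N (q : K * S) := forall p,
    (forall i, (i <= N)%N -> ball (xi q.1 i) N.+1%:R^-1 (xi p.1 i)) ->
    (forall i, (i <= N)%N -> ball (ze q.2 i) N.+1%:R^-1 (ze p.2 i)) -> U p.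
suff /filter_ex[N HN] : \forall N \near \oo, M `<=` P N.
  by exists N => p q /HN; apply.
apply: cov => q Mq.
have [[A B] /= [nA nB] AB] : nbhs q U by apply: open_nbhs_nbhs; split=> //; exact: MU.
have [N1 H1] := bxi nA; have [N2 H2] := bze nB.
have h1 := half_close q.1 N1 cxi; have h2 := half_close q.2 N2 cze.
set P1 := (X in nbhs _ X) in h1; set P2 := (X in nbhs _ X) in h2.
exists ([set q' | P1 q'.1 /\ P2 q'.2], [set N | (2 * (maxn N1 N2).+1 <= N)%N]) => /=.
  split; last exact: nbhs_infty_ge.
  by exists (P1, P2) => // q' [].
move=> [q' N] /= [[p1 p2] NN] p pK pS; apply: (AB p); split=> /=.
  by apply: H1; apply: p1 pK; move: NN; lia.
by apply: H2; apply: p2 pS; move: NN; lia.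
Qed.

End Tube.

(** * Cells met by a continuum *)

Section Cells.
Variables (R : realType) (K S : topologicalType).
Variables (xi : K -> nat -> R) (ze : S -> nat -> (R * R)%type) (n : nat -> nat).
Hypothesis n2 : forall i, (2 <= n i)%N.
Hypothesis cxi : forall i, continuous (xi ^~ i).
Hypothesis cze : forall i, continuous (ze ^~ i).
Hypothesis xiI : forall x i, 0 <= xi x i <= 1.
Hypothesis zeL : forall y, circle_inverse_limit n (ze y).
Variables (m k : nat).
Hypothesis k0 : (0 < k)%N.
Implicit Types (p q : K * S) (g h : int * int) (r : nat).

Let kR : R := k%:R.
Let kR0 : 0 < kR. Proof. by rewrite ltr0n. Qed.
Let s0 r : 0 < (span n m r)%:R :> R.
Proof. by rewrite ltr0n (leq_ltn_trans _ (span_gt n2 m r)). Qed.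

(* Cells are the open squares of half-width 1/k centered at the lattice points
   g/k of [0,1] x R; the circle of level m + r is seen as R modulo span n m r,
   so that [cell 0] lives at level m and [cell r] on a covering of it. *)
Definition box g (a t : R) := `|kR * a - g.1%:~R| < 1 /\ `|kR * t - g.2%:~R| < 1.

Definition cell r g p :=
  exists2 t : R, ze p.2 (m + r)%N = expi (t / (span n m r)%:R) &
    box g (xi p.1 m) t.

Lemma box_shift g a t (l : int) : box g a t -> box (shift (l * k%:Z) g) a (t + l%:~R).
Proof.
case=> h1 h2; split=> //=; rewrite intrD intrM (_ : _ - _ = kR * t - g.2%:~R) //.
by rewrite /kR -pmulrn; ring.
Qed.

Lemma box_adj g h a t : box g a t -> box h a t -> adj g h.
Proof.
case=> h1 h2 [h3 h4]; rewrite /adj.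
have aux (i j : int) (u : R) : `|u - i%:~R| < 1 -> `|u - j%:~R| < 1 -> `|i - j| <= 1.
  move=> hi hj; suff : `|i - j| < 2 by lia.
  rewrite -(ltr_int R) intr_norm intrB.
  have := ler_distD u i%:~R j%:~R; rewrite (distrC _ u) => h'.
  by rewrite (le_lt_trans h') // (_ : 2%:~R = 1 + 1 :> R) // ltrD.
by rewrite (aux _ _ _ h1 h3) (aux _ _ _ h2 h4).
Qed.

Lemma box_ex (a t : R) : 0 <= a <= 1 -> exists g, 0 <= g.1 <= k%:Z /\ box g a t.
Proof.
move=> aI; exists (Num.floor (kR * a), Num.floor (kR * t)); split=> /=.
  rewrite floor_ge0 mulr_ge0 ?(ltW kR0) //=; last by case/andP: aI.
  rewrite -(ler_int R) (le_trans (floor_le _)) // -pmulrn -/kR.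
  by case/andP: aI => _ a1; rewrite ler_piMr // ltW.
have aux (u : R) : `|u - (Num.floor u)%:~R| < 1.
  have := floor_le u; have := floorD1_gt u; rewrite intrD => h1 h2.
  by rewrite ger0_norm; lra.
by split; exact: aux.
Qed.

(** The center of the box has its first coordinate in [0, 1], so clipping cannot move a away from
    it. *)
Lemma box_clip g (a t : R) : 0 <= g.1 <= k%:Z -> box g a t -> box g (clip a) t.
Proof.
move=> /andP[g0 g1] [h1 h2]; split=> //.
have {}g0 : 0 <= g.1%:~R :> R by rewrite ler0z.
have {}g1 : g.1%:~R <= kR by rewrite /kR pmulrn ler_int.
have [a0|a0] := ltP a 0.
  have -> : clip a = 0 by rewrite /clip min_r ?max_l //; lra.
  have ka : kR * a < 0 by rewrite pmulr_rlt0.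
  by move: h1; rewrite mulr0 !ltr_norml; lra.
have [a1|a1] := ltP 1 a; last by rewrite clip_id // a0.
have -> : clip a = 1 by rewrite /clip min_l ?max_r //; lra.
have ka : kR < kR * a by rewrite ltr_pMr.
by move: h1; rewrite mulr1 !ltr_norml; lra.
Qed.

Lemma cell_ex r p : exists g, 0 <= g.1 <= k%:Z /\ cell r g p.
Proof.
have [t zt] := expi_surj (zeL p.2 (m + r)%N).1.
have [g [gk bg]] := box_ex (t * (span n m r)%:R) (xiI p.1 m).
by exists g; split=> //; exists (t * (span n m r)%:R) => //; rewrite mulfK ?gt_eqF.
Qed.

Lemma cell_base r p (t : R) : ze p.2 (m + r)%N = expi (t / (span n m r)%:R) ->
  ze p.2 m = expi t.
Proof. by move=> /(limit_coord (zeL _)) ->; rewrite mulrC divfK // gt_eqF. Qed.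

Lemma cell0P g p : cell 0 g p <-> exists2 t, ze p.2 m = expi t & box g (xi p.1 m) t.
Proof.
by split=> -[t zt bt]; exists t => //; move: zt;
  rewrite addn0 (_ : span n m 0 = 1%N) ?divr1 // /span big_ord0.
Qed.

Lemma cell_shift0 g p (l : int) : cell 0 g p -> cell 0 (shift (l * k%:Z) g) p.
Proof.
case/cell0P=> t zt bt; apply/cell0P; exists (t + l%:~R); first by rewrite expiDint.
exact: box_shift.
Qed.

Lemma open_cell r g : open [set p | cell r g p].
Proof.
rewrite openE => p [t zt [b1 b2]].
(* The room left inside the box, rescaled to an angle of level m + r. *)
pose e := (1 - `|kR * t - g.2%:~R|) / (kR * (span n m r)%:R).
have e0 : 0 < e by rewrite divr_gt0 ?mulr_gt0 // subr_gt0.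
have n1 : nbhs p.1 [set x | `|kR * xi x m - g.1%:~R| < 1].
  have c : continuous (fun x => `|kR * xi x m - g.1%:~R|).
    move=> x; apply: cvg_norm; apply: cvgB; last exact: cvg_cst.
    by apply: cvgM; [exact: cvg_cst|exact: cxi].
  by have /cvgr_lt /(_ _ b1) := c p.1.
have n2' : nbhs p.2 [set y | circle (ze y (m + r)%N) ->
    exists2 u, `|u - t / (span n m r)%:R| < e & expi u = ze y (m + r)%N].
  have h : nbhs (ze p.2 (m + r)%N) [set z | circle z ->
      exists2 u, `|u - t / (span n m r)%:R| < e & expi u = z].
    by rewrite zt; exact: expi_near.
  exact: (cze h).
rewrite /interior; exists ([set x | `|kR * xi x m - g.1%:~R| < 1],
  [set y | circle (ze y (m + r)%N) ->
    exists2 u, `|u - t / (span n m r)%:R| < e & expi u = ze y (m + r)%N]) => //.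
move=> q /= [q1 /(_ (zeL q.2 _).1)[u ue uz]].
exists (u * (span n m r)%:R); first by rewrite mulfK ?gt_eqF.
split=> //.
have h : `|kR * (u * (span n m r)%:R) - kR * t| < 1 - `|kR * t - g.2%:~R|.
  rewrite (_ : _ - _ = (u - t / (span n m r)%:R) * (kR * (span n m r)%:R)).
    by rewrite normrM [X in _ * X < _]gtr0_norm ?mulr_gt0 // -ltr_pdivlMr ?mulr_gt0.
  by field; rewrite gt_eqF.
have := ler_distD (kR * t) (kR * (u * (span n m r)%:R)) g.2%:~R; lra.
Qed.

Variable M : set (K * S).
Hypothesis conM : connected M.

(** Taken at level m even when cells of a covering are in use, which makes it periodic under one
    turn of level m, that is, k lattice units. *)
Definition hit g := 0 <= g.1 <= k%:Z /\ exists2 p, M p & cell 0 g p.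

Lemma hit_shift (l : int) g : hit g -> hit (shift (l * k%:Z) g).
Proof. by case=> gk [p Mp gp]; split=> //; exists p => //; exact: cell_shift0. Qed.

Lemma cell_hit r g p : 0 <= g.1 <= k%:Z -> M p -> cell r g p -> hit g.
Proof.
move=> gk Mp [t zt bt]; split=> //; exists p => //; apply/cell0P; exists t => //.
exact: cell_base zt.
Qed.

Lemma reach_hit g h : reach hit g h -> hit h.
Proof. by move=> /reach_sym /reach_l. Qed.

(** The two lifts of the angle of p differ by turns of level m + r, each worth [span n m r] turns of
    level m. Shifted accordingly, the second box shares a point with the first. *)
Lemma reach_overlap r g g1 g2 p : M p -> reach hit g g1 -> cell r g1 p ->
  0 <= g2.1 <= k%:Z -> cell r g2 p ->
  exists l : int, reach hit g (shift (l * (span n m r)%:Z * k%:Z) g2).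
Proof.
move=> Mp gg1 c1 g2k c2; have [g1k _] := reach_hit gg1.
have [t1 z1 b1] := c1; have [t2 z2 b2] := c2.
have /expi_eq[l tl] := etrans (esym z1) z2.
have t12 : t1 = t2 + (l * (span n m r)%:Z)%:~R.
  have s1 : (span n m r)%:R != 0 :> R by rewrite gt_eqF.
  rewrite intrM -pmulrn -[LHS](divfK s1) tl mulrDl divfK //.
exists l; apply: reach_trans gg1 _; apply: reach_adj.
- exact: cell_hit c1.
- by apply: hit_shift; exact: cell_hit c2.
- by apply: box_adj b1 _; rewrite t12; exact: box_shift.
Qed.

(** The cells in the class of g, and the cells none of whose shifts by turns of level m + r lies in
    it, have open unions. By [reach_overlap] these are complementary on M, which is connected. *)
Lemma cells_cover r g p0 : M p0 -> hit g -> cell r g p0 ->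
  forall p, M p -> exists2 g', reach hit g g' & cell r g' p.
Proof.
move=> Mp0 hg cg.
have rgg : reach hit g g by apply: reach_adj => //; exact: adjxx.
pose OA := \bigcup_(g1 in [set g1 | reach hit g g1]) [set p | cell r g1 p].
pose bad g2 := 0 <= g2.1 <= k%:Z /\
  forall l : int, ~ reach hit g (shift (l * (span n m r)%:Z * k%:Z) g2).
pose OB := \bigcup_(g2 in [set g2 | bad g2]) [set p | cell r g2 p].
have oA : open OA by apply: bigcup_open => g1 _; exact: open_cell.
have oB : open OB by apply: bigcup_open => g1 _; exact: open_cell.
have AB p : M p -> OA p <-> ~ OB p.
  move=> Mp; split=> [[g1 gg1 c1] [g2 [g2k nr] c2]|nOB].
    by have [l] := reach_overlap Mp gg1 c1 g2k c2; exact: nr.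
  have [g2 [g2k c2]] := cell_ex r p.
  have [l rl] : exists l : int, reach hit g (shift (l * (span n m r)%:Z * k%:Z) g2).
    by apply: contrapT => /forallNP nr; apply: nOB; exists g2.
  exists (shift (l * (span n m r)%:Z * k%:Z) g2) => //.
  have [t z2 b2] := c2; exists (t + (l * (span n m r)%:Z)%:~R); last exact: box_shift.
  by rewrite mulrDl intrM -pmulrn mulfK ?gt_eqF // expiDint.
have E : M `&` OA = M.
  apply: conM.
  - by exists p0; split=> //; exists g.
  - by exists OA.
  - exists (~` OB); first exact: open_closedC.
    by apply/seteqP; split=> p [Mp /(AB p Mp)].
move=> p Mp; have : (M `&` OA) p by rewrite E.
by case=> _ [g1 gg1 c1]; exists g1.
Qed.

Hypothesis M0 : M !=set0.
Hypothesis sndM : forall y, exists2 p, M p & p.2 = y.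
Hypothesis ze_onto : forall u, circle_inverse_limit n u -> exists y, ze y = u.

Lemma expi_onto i (t : R) : exists y, ze y i = expi t.
Proof.
have [p0 _] := M0.
have [th zth] := expi_surj (zeL p0.2 i).1.
have [h [_ hL ht _ _]] := limit_leaf n2 (zeL p0.2) zth.
by have [y yh] := ze_onto (hL t); exists y; rewrite yh ht.
Qed.

(** Points of M over k + 2 angles of level m + r lie in cells of one class. These have only k + 1
    possible first coordinates, so two cells agree there and differ by turns. *)
Lemma hit_winding : exists g (d : int), d != 0 /\ reach hit g (shift (d * k%:Z) g).
Proof.
(* Then N > k + 1, so that distinct indices j <= k + 1 stay distinct modulo N and the number of
   turns is not 0. *)
pose r := k.+1; set N := span n m r.
have Nr : (r < N)%N := span_gt n2 m r.
have [p0 Mp0] := M0; have [g0 [g0k c0]] := cell_ex r p0.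
have hg0 := cell_hit g0k Mp0 c0.
have /choice[G HG] : forall j : 'I_r.+1, exists g, reach hit g0 g /\
    exists l : int, g.2 = (j%:Z + l * N%:Z) * k%:Z.
  move=> j; have [y yj] := expi_onto (m + r) (j%:R / N%:R).
  have [p Mp py] := sndM y.
  have [g rg [t zt [_ b2]]] := cells_cover Mp0 hg0 c0 Mp.
  exists g; split=> //.
  move: zt; rewrite py yj => /esym/expi_eq[l tl].
  have tE : t = (j%:Z + l * N%:Z)%:~R.
    have sN : N%:R != 0 :> R by rewrite gt_eqF // /N.
    by rewrite -[LHS](divfK sN) tl mulrDl divfK // intrD intrM -!pmulrn.
  (* Here k t is an integer less than 1 away from the integer [g.2], so they are equal. *)
  exists l; move: b2; rewrite tE /kR pmulrn -intrM -intrB -intr_norm.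
  by rewrite (_ : 1 = 1%:~R :> R) // ltr_int; clear; lia.
have Gk j : (`|(G j).1| < k.+1)%N by have [/reach_hit[/andP[? ?] _] _] := HG j; lia.
pose phi j := Ordinal (Gk j).
have [i [j [ij eij]]] : exists i j, i != j /\ phi i = phi j.
  have /injectivePn[i [j ij eij]] : ~~ injectiveb phi; last by exists i, j.
  apply/injectiveP => /leq_card; rewrite !card_ord; lia.
have [ri [li Gi]] := HG i; have [rj [lj Gj]] := HG j.
exists (G i), (j%:Z - i%:Z + (lj - li) * N%:Z); split.
  have iN : (i < N)%N := leq_trans (ltn_ord i) Nr.
  have jN : (j < N)%N := leq_trans (ltn_ord j) Nr.
  have {}ij : nat_of_ord i <> j by move=> e; case/eqP: ij; exact: val_inj.
  have mN (z : int) : 0 < z -> N%:Z <= z * N%:Z by move=> z0; rewrite ler_peMl.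
  apply/eqP; have [z0|z0|->] := ltrgtP (lj - li) 0; last by move: ij; clear; lia.
    by have := mN (- (lj - li)) _; rewrite oppr_gt0 mulNr => /(_ z0); move: iN jN; clear; lia.
  by have := mN _ z0; move: iN jN; clear; lia.
have -> : shift ((j%:Z - i%:Z + (lj - li) * N%:Z) * k%:Z) (G i) = G j.
  rewrite [RHS]surjective_pairing /shift Gi Gj; congr (_, _); last by ring.
  have := congr1 val eij; rewrite /= => e.
  have [/reach_hit[/andP[? ?] _] _] := HG i; have [/reach_hit[/andP[? ?] _] _] := HG j.
  by lia.
exact: reach_trans (reach_sym ri) rj.
Qed.

(** With r = 0, [cells_cover] and [reach_overlap] reach every cell up to turns; the winding and
    [reach_all] remove the turns. *)
Lemma hit_connected g h : hit g -> hit h -> reach hit g h.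
Proof.
have [g0 [d [d0 gd]]] := hit_winding.
have hg0 := reach_l gd.
suff all_ h' : hit h' -> reach hit g0 h'.
  by move=> /all_ r1 /all_ r2; exact: reach_trans (reach_sym r1) r2.
apply: (reach_all hit_shift _ d0 gd); first by rewrite ltz_nat.
move=> h1 [h1k [p Mp c1]].
have [_ [p0 Mp0 c0]] := hg0.
have [g' rg' c'] := cells_cover Mp0 hg0 c0 Mp.
have [l] := reach_overlap Mp rg' c' h1k c1.
by rewrite (_ : span n m 0 = 1%N) ?mulr1 => [|]; [exists l|rewrite /span big_ord0].
Qed.

End Cells.

(** * The neighborhood of the continuum *)

Section CellNeighborhood.
Variables (R : realType) (K S : topologicalType).
Variables (xi : K -> nat -> R) (ze : S -> nat -> (R * R)%type).
Variables (f : nat -> R -> R) (n : nat -> nat).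
Hypothesis f_open : forall i, open_surj_I01_map (f i).
Hypothesis n2 : forall i, (2 <= n i)%N.
Hypothesis xi_inj : injective xi.
Hypothesis ze_inj : injective ze.
Hypothesis cxi : forall i, continuous (xi ^~ i).
Hypothesis cze : forall i, continuous (ze ^~ i).
Hypothesis bxi : basic_coords xi.
Hypothesis bze : basic_coords ze.
Hypothesis xiL : forall x, arc_inverse_limit f (xi x).
Hypothesis zeL : forall y, circle_inverse_limit n (ze y).
Hypothesis xi_onto : forall u, arc_inverse_limit f u -> exists x, xi x = u.
Hypothesis ze_onto : forall u, circle_inverse_limit n u -> exists y, ze y = u.
Variables (m k : nat).
Hypothesis k0 : (0 < k)%N.
Variable M : set (K * S).
Hypothesis conM : connected M.
Hypothesis M0 : M !=set0.
Hypothesis fstM : forall x, exists2 p, M p & p.1 = x.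
Hypothesis sndM : forall y, exists2 p, M p & p.2 = y.

Notation cell := (cell xi ze n m k 0).
Notation hit := (hit xi ze n m k M).
Notation box := (@box R k).

Definition cell_nbhd := \bigcup_(g in [set g | hit g]) [set p | cell g p].

Let xiI x i : 0 <= xi x i <= 1.
Proof. by have [+ _] := xiL x i; rewrite /I01 /= in_itv. Qed.

Lemma open_cell_nbhd : open cell_nbhd.
Proof. by apply: bigcup_open => g _; exact: open_cell. Qed.

Lemma sub_cell_nbhd : M `<=` cell_nbhd.
Proof.
move=> p Mp; have [g [gk cg]] := cell_ex n2 xiI zeL m k0 0 p.
by exists g => //; exact: (cell_hit n2 zeL gk Mp cg).
Qed.

(** The lift t may be prescribed because [hit] is periodic. *)
Lemma cell_nbhdP x y t : ze y m = expi t -> cell_nbhd (x, y) ->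
  exists2 g, hit g & box g (xi x m) t.
Proof.
move=> zt [g hg /cell0P[t' zt' b]].
have /expi_eq[l ->] := etrans (esym zt) zt'.
by exists (shift (l * k%:Z) g); [exact: hit_shift|exact: box_shift].
Qed.

Section Leaf.
(** [sK] and [sS] lay the strip into the product as a sheet over level m. B is a relatively clopen
    part of [cell_nbhd], in the form used by [connected]. *)
Variables (sK : R -> K) (sS : R -> S).
Hypothesis csK : continuous sK.
Hypothesis csS : continuous sS.
Hypothesis sKm : forall a, xi (sK a) m = clip a.
Hypothesis sSm : forall t, ze (sS t) m = expi t.
Variables B C1 C2 : set (K * S).
Hypothesis oC1 : open C1.
Hypothesis cC2 : closed C2.
Hypothesis BC1 : B = cell_nbhd `&` C1.
Hypothesis BC2 : B = cell_nbhd `&` C2.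

Lemma leaf_box g a t : hit g -> box g a t -> cell_nbhd (sK a, sS t).
Proof.
move=> hg b; exists g => //; apply/cell0P; exists t; first exact: sSm.
by rewrite sKm; apply: box_clip b => //; case: hg.
Qed.

(** A box is convex: a segment in it has a connected image in [cell_nbhd], which the clopen set B
    contains or misses. *)
Lemma leaf_box_connected g a t a' t' : hit g -> box g a t -> box g a' t' ->
  B (sK a, sS t) -> B (sK a', sS t').
Proof.
move=> hg [b1 b2] [b1' b2'] Bat.
pose psi (u : R) := (sK (a + u * (a' - a)), sS (t + u * (t' - t))).
have line (c c' : R) : continuous (fun u : R => c + u * (c' - c)).
  move=> u; apply: cvgD; first exact: cvg_cst.
  by apply: cvgM; [exact: cvg_id|exact: cvg_cst].
have cpsi : continuous psi.
  move=> u; apply: (@cvg_pair _ _ _ _ (nbhs (sK (a + u * (a' - a)))) (nbhs (sS (t + u * (t' - t))))).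
    exact: continuous_comp (line a a' u) (@csK _).
  exact: continuous_comp (line t t' u) (@csS _).
have conv (c c' v w u : R) : 0 <= u <= 1 -> `|v * c - w| < 1 -> `|v * c' - w| < 1 ->
    `|v * (c + u * (c' - c)) - w| < 1.
  move=> uI; rewrite (_ : v * (c + _) - w = (1 - u) * (v * c - w) + u * (v * c' - w)).
    set X := v * c - w; set Y := v * c' - w => X1 Y1.
    pose Z := Num.max `|X| `|Y|.
    have Z1 : Z < 1 by rewrite gt_max X1.
    have hX : (1 - u) * `|X| <= (1 - u) * Z by rewrite ler_wpM2l ?le_max ?lexx //; lra.
    have hY : u * `|Y| <= u * Z by rewrite ler_wpM2l ?le_max ?lexx ?orbT //; lra.
    have := ler_normD ((1 - u) * X) (u * Y).
    by rewrite !normrM (ger0_norm (x := u)) ?(ger0_norm (x := 1 - u)); lra.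
  by ring.
have con := connected_continuous_connected (@segment_connected R 0 1)
  (continuous_subspaceT cpsi).
have sub : psi @` `[0, 1] `<=` cell_nbhd.
  move=> _ [u /= uI <-]; rewrite in_itv /= in uI.
  by apply: (leaf_box hg); split; exact: conv.
have psi0 : psi 0 = (sK a, sS t) by rewrite /psi !mul0r !addr0.
have psi1 : psi 1 = (sK a', sS t') by rewrite /psi !mul1r ![_ + (_ - _)]addrC !subrK.
have E : psi @` `[0, 1] `&` B = psi @` `[0, 1].
  apply: con.
  - by exists (psi 0); split; [exists 0; rewrite //= in_itv /= lexx ler01|rewrite psi0].
  - by exists C1 => //; rewrite BC1 setIA (setIidl sub).
  - by exists C2 => //; rewrite BC2 setIA (setIidl sub).
have : (psi @` `[0, 1] `&` B) (psi 1).
  by rewrite E; exists 1; rewrite //= in_itv /= lexx ler01.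
by rewrite psi1 => -[].
Qed.

Lemma leaf_connected a t a' t' : 0 <= a <= 1 -> 0 <= a' <= 1 ->
  B (sK a, sS t) -> cell_nbhd (sK a', sS t') -> B (sK a', sS t').
Proof.
move=> aI a'I Bat Wat'.
have Wat : cell_nbhd (sK a, sS t) by move: Bat; rewrite BC1 => -[].
have [g hg bg] := cell_nbhdP (sSm t) Wat; rewrite sKm clip_id // in bg.
have [g' hg' bg'] := cell_nbhdP (sSm t') Wat'; rewrite sKm clip_id // in bg'.
have kR : k%:R != 0 :> R by rewrite pnatr_eq0 -lt0n.
have [w [N [w0 wN hw aw]]] := hit_connected n2 cxi cze xiI zeL k0 conM M0 sndM ze_onto hg hg'.
suff all_ s : forall b u, box (w s) b u -> B (sK b, sS u).
  by apply: (all_ N); rewrite wN.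
elim: s => [|s IH] b u bw.
  by move: bw; rewrite w0 => bw; exact: leaf_box_connected hg bg bw Bat.
(* The midpoint of the centers of adjacent boxes lies in both boxes, so B passes from one to the
   next. *)
pose mid (i j : int) : R := (i%:~R + j%:~R) / 2 / k%:R.
have aux (i j : int) : `|i - j| <= 1 -> `|k%:R * mid i j - i%:~R| < 1 /\ `|k%:R * mid i j - j%:~R| < 1.
  move=> ij; have : `|i%:~R - j%:~R| <= 1 :> R by rewrite -intrB -intr_norm (ler_int _ _ 1).
  rewrite /mid mulrC divfK // !ltr_norml ler_norml => /andP[? ?].
  by split; apply/andP; split; lra.
have /andP[a1 a2] := aw s.
have [m1 m1'] := aux _ _ a1; have [m2 m2'] := aux _ _ a2.
apply: (leaf_box_connected (g := w s.+1) (a := mid (w s).1 (w s.+1).1) (t := mid (w s).2 (w s.+1).2)) => //.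
by apply: IH; split.
Qed.

End Leaf.

(** The point y' need not be on the leaf of y, but points of that leaf over the same angle
    approximate it. They lie in B by [leaf_connected], and B is relatively closed. *)
Lemma connected_fiber B C1 C2 x y y' : open C1 -> closed C2 ->
  B = cell_nbhd `&` C1 -> B = cell_nbhd `&` C2 ->
  B (x, y) -> cell_nbhd (x, y') -> B (x, y').
Proof.
move=> oC1 cC2 BC1 BC2 Bxy Wxy'.
have [s [cs sL sm sx]] := inverse_limit_section m f_open (xiL x).
have /choice[sK sKs] : forall a, exists x, xi x = s a by move=> a; exact: xi_onto.
have csK : continuous sK.
  apply: (continuous_coords bxi) => i; rewrite (_ : (fun a => _) = s ^~ i) //.
  by apply/funext => a; rewrite sKs.
have [th zth] := expi_surj (zeL y m).1.
have [h [ch hL hm hth hdense]] := limit_leaf n2 (zeL y) zth.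
have /choice[sS sSh] : forall t, exists y, ze y = h t by move=> t; exact: ze_onto.
have csS : continuous sS.
  apply: (continuous_coords bze) => i; rewrite (_ : (fun a => _) = h ^~ i) //.
  by apply/funext => a; rewrite sSh.
have sKx : sK (xi x m) = x by apply: xi_inj; rewrite sKs.
have sSy : sS th = y by apply: ze_inj; rewrite sSh.
have [t zt] := expi_surj (zeL y' m).1.
have inB l : B (x, sS (t + l%:~R)).
  have W' : cell_nbhd (x, sS (t + l%:~R)).
    have [g hg b] := cell_nbhdP zt Wxy'; exists g => //; apply/cell0P.
    by exists t => //=; rewrite sSh hm expiDint.
  rewrite -sKx; apply: (@leaf_connected sK sS csK csS _ _ B C1 C2 oC1 cC2 BC1 BC2 (xi x m) th) => //.
  - by move=> a; rewrite sKs.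
  - by move=> u; rewrite sSh.
  - by rewrite sKx sSy.
  - by rewrite sKx.
rewrite BC2; split=> //; apply: contrapT => nC2.
have [[A1 A2] /= [nA1 nA2] A12] : nbhs (x, y') (~` C2).
  by apply: open_nbhs_nbhs; split=> //; exact: closed_openC.
have [N HN] := bze nA2.
have [l hl] := hdense _ _ (zeL y') zt N.
have : (~` C2) (x, sS (t + l%:~R)).
  apply: (A12 (_, _)); split=> /=; first exact: nbhs_singleton.
  apply: HN => i iN; rewrite sSh hl //; apply: ballxx.
  by rewrite invr_gt0 ltr0n.
by apply; move: (inB l); rewrite BC2 => -[].
Qed.

(** As M projects onto K, [connected_fiber] moves a point of B to a point of M. Then B contains the
    connected set M, and fibers through M carry it to all of [cell_nbhd]. *)
Lemma connected_cell_nbhd : connected cell_nbhd.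
Proof.
move=> B [p0 Bp0] [C1 oC1 BC1] [C2 cC2 BC2].
have fiber := connected_fiber oC1 cC2 BC1 BC2.
have BW : B `<=` cell_nbhd by rewrite BC1 => p [].
have MB : M `&` B = M.
  apply: conM.
  - have [[x y] Mq /= xp] := fstM p0.1; exists (x, y); split=> //.
    apply: (fiber _ p0.2); last exact: sub_cell_nbhd.
    by rewrite xp -surjective_pairing.
  - by exists C1 => //; rewrite BC1 setIA (setIidl sub_cell_nbhd).
  - by exists C2 => //; rewrite BC2 setIA (setIidl sub_cell_nbhd).
apply/seteqP; split=> // -[x y] Wxy.
have [[x' y'] Mq /= xx'] := fstM x.
apply: (fiber _ y') => //; rewrite -xx'.
have : (M `&` B) (x', y') by rewrite MB.
by case.
Qed.

End CellNeighborhood.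

Theorem theorem2 (R : realType) (K S : topologicalType) :
  is_Knaster_continuum R K -> is_solenoid R S -> fupcon K S.
Proof.
case=> f [f_open /homeomorphic_coordinates[xi [xi_inj cxi bxi xiL xi_onto]]].
case=> n [n2 /homeomorphic_coordinates[ze [ze_inj cze bze zeL ze_onto]]].
move=> M [M0 cM conM] fstM sndM U oU MU.
(* The same m serves as the level of the cells and as the precision 1/(m + 1). *)
have [m Hm] := compact_tube cxi cze bxi bze cM oU MU.
have m0 : 0 < m.+1%:R^-1 :> R by rewrite invr_gt0 ltr0n.
have [d1 d10 H1] := arc_limit_unif m f_open m0.
have [d2 d20 H2] := circle_limit_unif m n2 m0.
pose d := Num.min d1 d2.
have d0 : 0 < d by rewrite lt_min d10.
(* Two points of one box differ by less than 2/k < d in each coordinate. *)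
pose k := (Num.truncn (2 / d)).+1.
have kd : 2 < k%:R * d by rewrite -ltr_pdivrMr //; exact: truncnS_gt.
have fstM' x : exists2 p, M p & p.1 = x.
  have : (fst @` M) x by rewrite fstM.
  by case=> p; exists p.
have sndM' y : exists2 p, M p & p.2 = y.
  have : (snd @` M) y by rewrite sndM.
  by case=> p; exists p.
exists (cell_nbhd xi ze n m k M); split.
- by apply: (open_cell_nbhd n2 cxi cze zeL).
- by apply: (connected_cell_nbhd f_open n2 xi_inj ze_inj cxi cze bxi bze xiL zeL xi_onto ze_onto).
- by apply: (sub_cell_nbhd n2 xiL zeL).
move=> p [g [_ [q Mq /cell0P[t zt [a1 a2]]]] /cell0P[t' zt' [b1 b2]]].
have close (u v w : R) : `|k%:R * u - w| < 1 -> `|k%:R * v - w| < 1 -> `|u - v| < d.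
  move=> hu hv; have kR0 : 0 < k%:R :> R by rewrite ltr0n.
  rewrite -(ltr_pM2l kR0) -{1}(gtr0_norm kR0) -normrM mulrBr.
  by have := ler_distD w (k%:R * u) (k%:R * v); rewrite (distrC w); lra.
apply: (Hm p q Mq) => i im.
  apply: H1 im => //; have := close _ _ _ a1 b1; by rewrite lt_min => /andP[].
by apply: H2 zt zt' _ i im => //; have := close _ _ _ a2 b2; rewrite lt_min => /andP[].
Qed.
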